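(* Let $\widehat A = \widehat A \{ \Sigma_+ , C_+ , \Sigma_- , C_- \}$, where $\Sigma_\pm$ satisfy $\int(1+t^2)^{-1}d\Sigma_\pm<\infty$, $\int d\Sigma_\pm=\infty$, $\Sigma_\pm(t)=\frac12(\Sigma_\pm(t-0)+\Sigma_\pm(t+0))$, $\Sigma_\pm(0)=0$, and $C_\pm$ are arbitrary real constants. Let $\Phi := M_{\Sigma_+,C_+} - M_{\Sigma_-,C_-}$. Then: 1) If $\lambda \in \mathfrak{A}_0 (\Sigma_+) \cup \mathfrak{A}_0 (\Sigma_-)$, then $ \lambda \not \in \sigma_p (\widehat A)$. 2) If $\lambda \in \mathfrak{A}_p (\Sigma_+) \cap \mathfrak{A}_p (\Sigma_-)$, then (i) $\lambda$ is an eigenvalue of geometric multiplicity 1; (ii) $\lambda$ is simple iff at least one of $d\Sigma_- (\{ \lambda \} ) = d\Sigma_+ ( \{ \lambda \} )$, $\int_{\mathbb R \setminus \{\lambda \}} |t-\lambda |^{-2} d \Sigma_+ (t) < \infty$, $\int_{\mathbb R \setminus \{\lambda \}} |t-\lambda |^{-2} d \Sigma_- (t) < \infty$ fails; (iii) if these three hold, the algebraic multiplicity of $\lambda$ is the greatest $k\in\{2,3,\dots\}\cup\{+\infty\}$ such that \[ \int_{\mathbb R \setminus \{\lambda \}} \frac{d \Sigma_\pm (t)}{|t-\lambda|^{2j}} < \infty \quad\text{and}\quad \lim_{\varepsilon \to 0,\ \varepsilon \in \mathbb R} \Phi^{(j-2)} (\lambda+i\varepsilon) = 0 \] for all $2 \leq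 j \leq k-1$ (in particular $k=2$ if one of these fails for $j=2$). 3) If $\lambda \in \mathfrak{A}_r (\Sigma_+) \cap \mathfrak{A}_r (\Sigma_-)$, then $\lambda \in \sigma_p (\widehat A)$ iff $\lim_{\varepsilon \to 0} \Phi (\lambda+i\varepsilon) = 0$. In this case the geometric multiplicity is 1 and the algebraic multiplicity is the greatest $k$ ($1 \leq k \leq \infty$) such that $\int_{\mathbb R} |t-\lambda |^{-2j} d \Sigma_\pm (t) < \infty$ and $\lim_{\varepsilon \to 0} \Phi^{(j-1)} (\lambda+i\varepsilon) = 0$ for all $1 \leq j \leq k$. 4) If $\lambda \in \mathfrak{A}_p (\Sigma_+) \cap \mathfrak{A}_r (\Sigma_-)$ or $\lambda \in \mathfrak{A}_p (\Sigma_-) \cap \mathfrak{A}_r (\Sigma_+)$, then $\lambda \not \in \sigma_p (\widehat A)$.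
   Context: $Q_\Sigma$ is multiplication by $t$ in $L^2(\mathbb R,d\Sigma)$; $\sigma_c(S):=\{\lambda\notin\sigma_p(S): \operatorname{ran}(S-\lambda)\ne\overline{\operatorname{ran}(S-\lambda)}=H\}$. $\mathfrak A_0(\Sigma)=\{\lambda\in\sigma_c(Q_\Sigma):\int|t-\lambda|^{-2}d\Sigma=\infty\}$, $\mathfrak A_r(\Sigma)=\{\lambda\notin\sigma_p(Q_\Sigma):\int|t-\lambda|^{-2}d\Sigma<\infty\}$, $\mathfrak A_p(\Sigma)=\sigma_p(Q_\Sigma)$; $d\Sigma(\{\lambda\})=\Sigma(\lambda+0)-\Sigma(\lambda-0)$. $M_{\Sigma,C}(\lambda)=C+\int\big((t-\lambda)^{-1}-t(1+t^2)^{-1}\big)d\Sigma(t)$. $T_\Sigma^*$ has domain $\{f=f_Q+\mathfrak c\,t(t^2+1)^{-1}: f_Q\in\operatorname{dom}(Q_\Sigma)\}$, $T_\Sigma^*f=tf_Q-\mathfrak c(t^2+1)^{-1}$, $\Gamma_0^\Sigma f=\mathfrak c$, $\Gamma_1^{\Sigma,C}f=\mathfrak cC+\int f_Q d\Sigma$; $\widehat A\{\Sigma_+,C_+,\Sigma_-,C_-\}$ is the restriction of $T_{\Sigma_+}^*\oplus T_{\Sigma_-}^*$ in $L^2(d\Sigma_+)\oplus L^2(d\Sigma_-)$ to $\{f_++f_-:\Gamma_0^{\Sigma_+}f_+=\Gamma_0^{\Sigma_-}f_-,\ \Gamma_1^{\Sigma_+,C_+}f_+=\Gamma_1^{\Sigma_-,C_-}f_-\}$.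 *)

(* Defs.v *)
From mathcomp Require Import all_boot all_order all_algebra.
From mathcomp Require Import all_classical all_reals all_analysis.
From mathcomp Require Import complex.
Import Order.TTheory GRing.Theory Num.Theory.
Local Open Scope ring_scope.
Local Open Scope classical_set_scope.

Set Implicit Arguments.
Unset Strict Implicit.
Unset Printing Implicit Defensive.

Definition cR (R : realType) (x : R) : R[i] := Complex x 0.
Definition ci (R : realType) : R[i] := Complex 0 1.

Definition cRe (R : realType) (z : R[i]) : R := complex.Re z.
Definition cIm (R : realType) (z : R[i]) : R := complex.Im z.

Definition cabs2 (R : realType) (z : R[i]) : R := cRe z ^+ 2 + cIm z ^+ 2.

Definition inL2 (R : realType) (mu : {measure set R -> \bar R}) (f : R -> R[i]) :=
  [/\ measurable_fun setT (fun t => cRe (f t)),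
      measurable_fun setT (fun t => cIm (f t)) &
      (\int[mu]_t (cabs2 (f t))%:E < +oo)%E].

Definition L2dist2 (R : realType) (mu : {measure set R -> \bar R}) (f g : R -> R[i]) : \bar R :=
  (\int[mu]_t (cabs2 (f t - g t))%:E)%E.

Definition aeeq (R : realType) (mu : {measure set R -> \bar R}) (f g : R -> R[i]) :=
  mu.-negligible [set t | f t <> g t].

Definition aezero (R : realType) (mu : {measure set R -> \bar R}) (f : R -> R[i]) :=
  aeeq mu f (fun=> 0).

Definition cint (R : realType) (mu : {measure set R -> \bar R}) (D : set R) (f : R -> R[i]) : R[i] :=
  cR (Rintegral mu D (fun t => cRe (f t))) + ci R * cR (Rintegral mu D (fun t => cIm (f t))).

Definition domQ (R : realType) (mu : {measure set R -> \bar R}) (f : R -> R[i]) :=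
  inL2 mu f /\ inL2 mu (fun t => (cR t) * f t).

Definition sigma_pQ (R : realType) (mu : {measure set R -> \bar R}) (lam : R[i]) :=
  exists f, domQ mu f /\ ~ aezero mu f /\ aeeq mu (fun t => (cR t) * f t) (fun t => lam * f t).

Definition ranQ (R : realType) (mu : {measure set R -> \bar R}) (lam : R[i]) (g : R -> R[i]) :=
  exists f, domQ mu f /\ aeeq mu g (fun t => ((cR t) - lam) * f t).

Definition sigma_cQ (R : realType) (mu : {measure set R -> \bar R}) (lam : R[i]) :=
  [/\ ~ sigma_pQ mu lam,
      (forall h, inL2 mu h -> forall e : R, 0 < e ->
         exists g, ranQ mu lam g /\ (L2dist2 mu h g < e%:E)%E) &
      (* the range is not closed, i.e. differs from its closure H *)
      (exists h, inL2 mu h /\ ~ ranQ mu lam h)].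

Definition wpow (R : realType) (lam : R[i]) (j : nat) (t : R) : R :=
  (cabs2 ((cR t) - lam))^-1 ^+ j.

Definition A0 (R : realType) (mu : {measure set R -> \bar R}) (lam : R[i]) :=
  sigma_cQ mu lam /\ (\int[mu]_t (wpow lam 1 t)%:E = +oo)%E.
Definition Ar (R : realType) (mu : {measure set R -> \bar R}) (lam : R[i]) :=
  ~ sigma_pQ mu lam /\ (\int[mu]_t (wpow lam 1 t)%:E < +oo)%E.
Definition Ap (R : realType) (mu : {measure set R -> \bar R}) (lam : R[i]) :=
  sigma_pQ mu lam.

Definition atom (R : realType) (mu : {measure set R -> \bar R}) (lam : R[i]) : \bar R :=
  mu [set t | (cR t) = lam].

Definition Mfun (R : realType) (mu : {measure set R -> \bar R}) (C : R) (z : R[i]) : R[i] :=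
  (cR C) + cint mu setT (fun t => ((cR t) - z)^-1 - cR (t / (1 + t ^+ 2))).

Definition has_cderiv (R : realType) (F : R[i] -> R[i]) (z l : R[i]) :=
  forall e : R, 0 < e -> exists d : R, 0 < d /\
    forall h : R[i], h != 0 -> `|h| < (cR d) -> `|(F (z + h) - F z) / h - l| < (cR e).

Definition cderiv (R : realType) (F : R[i] -> R[i]) (z : R[i]) : R[i] :=
  xget 0 (fun l => has_cderiv F z l).

Fixpoint cderivn (R : realType) (n : nat) (F : R[i] -> R[i]) : R[i] -> R[i] :=
  match n with
  | 0 => F
  | n'.+1 => cderiv (cderivn n' F)
  end.

Definition lim0_vertical (R : realType) (F : R[i] -> R[i]) (lam : R[i]) :=
  forall e : R, 0 < e -> exists d : R, 0 < d /\
    forall eps : R, eps != 0 -> `|eps| < d -> `|F (lam + ci R * (cR eps))| < (cR e).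

Definition vec (R : realType) := ((R -> R[i]) * (R -> R[i]))%type.

Definition vzero (R : realType) (mup mum : {measure set R -> \bar R}) (v : vec R) :=
  aezero mup v.1 /\ aezero mum v.2.

Definition vscale (R : realType) (a : R[i]) (v : vec R) : vec R :=
  (fun t => a * v.1 t, fun t => a * v.2 t).

Definition vsub (R : realType) (v w : vec R) : vec R :=
  (fun t => v.1 t - w.1 t, fun t => v.2 t - w.2 t).

Definition ht (R : realType) (t : R) : R[i] := cR (t / (t ^+ 2 + 1)).
Definition kt (R : realType) (t : R) : R[i] := cR ((t ^+ 2 + 1)^-1).

(* graph of T_Sigma^*:  f = f_Q + c t/(t^2+1),  T^* f = t f_Q - c/(t^2+1);
   Gamma_0 f = c, Gamma_1 f = c C + \int f_Q dSigma *)
Definition Tstar_data (R : realType) (mu : {measure set R -> \bar R})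
  (f g : R -> R[i]) (fQ : R -> R[i]) (c : R[i]) :=
  [/\ domQ mu fQ, aeeq mu f (fun t => fQ t + c * ht t) &
      aeeq mu g (fun t => (cR t) * fQ t - c * kt t)].

Definition Gamma1 (R : realType) (mu : {measure set R -> \bar R}) (C : R)
  (fQ : R -> R[i]) (c : R[i]) : R[i] := c * (cR C) + cint mu setT fQ.

Definition Ahat_graph (R : realType) (mup : {measure set R -> \bar R}) (Cp : R)
  (mum : {measure set R -> \bar R}) (Cm : R) (f g : vec R) :=
  exists (fp fm : R -> R[i]) (cp cm : R[i]),
    [/\ Tstar_data mup f.1 g.1 fp cp, Tstar_data mum f.2 g.2 fm cm,
        cp = cm (* Gamma_0 f+ = Gamma_0 f- *) &
        Gamma1 mup Cp fp cp = Gamma1 mum Cm fm cm].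

Definition in_ker_pow (R : realType) (mup : {measure set R -> \bar R}) (Cp : R)
  (mum : {measure set R -> \bar R}) (Cm : R) (lam : R[i]) (n : nat) (f : vec R) :=
  exists ch : nat -> vec R,
    [/\ ch 0%N = f,
        (forall k, (k < n)%N -> exists g, Ahat_graph mup Cp mum Cm (ch k) g /\
                              ch k.+1 = vsub g (vscale lam (ch k))) &
        vzero mup mum (ch n)].

Definition eigenspace (R : realType) (mup : {measure set R -> \bar R}) (Cp : R)
  (mum : {measure set R -> \bar R}) (Cm : R) (lam : R[i]) : set (vec R) :=
  in_ker_pow mup Cp mum Cm lam 1.

Definition rootspace (R : realType) (mup : {measure set R -> \bar R}) (Cp : R)
  (mum : {measure set R -> \bar R}) (Cm : R) (lam : R[i]) : set (vec R) :=
  fun f => exists n, in_ker_pow mup Cp mum Cm lam n f.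

Definition sigma_pA (R : realType) (mup : {measure set R -> \bar R}) (Cp : R)
  (mum : {measure set R -> \bar R}) (Cm : R) (lam : R[i]) :=
  exists f, ~ vzero mup mum f /\ Ahat_graph mup Cp mum Cm f (vscale lam f).

Definition lin_indep (R : realType) (mup mum : {measure set R -> \bar R}) (n : nat)
  (v : 'I_n -> vec R) :=
  forall a : 'I_n -> R[i],
    vzero mup mum (fun t => \sum_(i < n) a i * (v i).1 t, fun t => \sum_(i < n) a i * (v i).2 t) ->
    forall i, a i = 0.

Definition dim_ge (R : realType) (mup mum : {measure set R -> \bar R}) (S : set (vec R)) (n : nat) :=
  exists v : 'I_n -> vec R, (forall i, S (v i)) /\ lin_indep mup mum v.

Definition dim_eq (R : realType) (mup mum : {measure set R -> \bar R}) (S : set (vec R))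
  (k : option nat) :=
  match k with
  | Some n => dim_ge mup mum S n /\ ~ dim_ge mup mum S n.+1
  | None => forall n, dim_ge mup mum S n
  end.

Definition geom_mult (R : realType) (mup : {measure set R -> \bar R}) (Cp : R)
  (mum : {measure set R -> \bar R}) (Cm : R) (lam : R[i]) (k : option nat) :=
  dim_eq mup mum (eigenspace mup Cp mum Cm lam) k.

Definition alg_mult (R : realType) (mup : {measure set R -> \bar R}) (Cp : R)
  (mum : {measure set R -> \bar R}) (Cm : R) (lam : R[i]) (k : option nat) :=
  dim_eq mup mum (rootspace mup Cp mum Cm lam) k.

Definition ole (a b : option nat) : Prop :=
  match a, b with
  | _, None => True
  | None, Some _ => False
  | Some m, Some n => (m <= n)%N
  end.

Definition is_greatest (P : option nat -> Prop) (k : option nat) :=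
  P k /\ forall k', P k' -> ole k' k.

(* Main.v *)
(* Put [u t = (t - lam)^-1], with [u lam = 0], and let [chi] be the indicator of
   [{lam}].  The relation [g - lam f = w] in the graph of [Ahat] says that, for a
   constant [c] common to both sides, [(t - lam) f = w + c] almost everywhere,
   plus the [Gamma_1] coupling.  Hence every root vector is [u p(u) + b chi] on
   each side, with one polynomial [p] and two values [b+], [b-]; one more step of
   the chain replaces [p] by [p X + c] and, at an atom, forces [b = -c].  Square
   integrability of [u p(u)] is finiteness of the integrals of
   [|t - lam|^(-2 j)] for [j <= deg p + 1], and the coupling reads
   [b+ m+ - b- m- + sum_i p_i F_i = 0], where [F_i] is the difference of the
   (regularised) moments of [u^(i+1)].  Inductively this forces [F_i = 0] for
   [i <= deg p] without atoms, and [m+ = m-], [F_i = 0] for [i < deg p] with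
   atoms; conversely these conditions let one build a chain from the powers of
   [u].  Finally the derivatives of [Phi] off the real line are [n!] times the
   moment differences at that point, and they converge along the vertical line
   through [lam] to [n! F_n], the contributions of equal atoms cancelling; the
   error is [O(eps)] with constant the integral of [|u|^(n+2)]. *)
Require Import Defs.
From mathcomp Require Import all_boot all_order all_algebra.
From mathcomp Require Import all_classical all_reals all_analysis.
From mathcomp Require Import measurable_realfun complex.
From mathcomp Require Import ring lra.
Import Order.TTheory GRing.Theory Num.Theory.
Local Open Scope ring_scope.
Local Open Scope classical_set_scope.
Set Implicit Arguments.
Unset Strict Implicit.
Unset Printing Implicit Defensive.
Import Normc.

(** * Complex-valued functions: measurability, integrals, square integrability *)

Section ComplexValued.
Variable R : realType.
Implicit Types (z w : R[i]) (f g : R -> R[i]) (h k : R -> R) (mu : {measure set R -> \bar R}).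

Lemma cabs2E z : cabs2 z = normc z ^+ 2.
Proof.
by case: z => a b; rewrite /cabs2 /= sqr_sqrtr // addr_ge0 ?sqr_ge0.
Qed.

Lemma normc_ge0 z : 0 <= normc z.
Proof. by case: z => a b; exact: sqrtr_ge0. Qed.

Lemma normrE z : `|z| = cR (normc z).
Proof. by case: z. Qed.

Lemma ltcR_normc z (e : R) : (`|z| < cR e) = (normc z < e).
Proof. by rewrite normrE ltcR. Qed.

Lemma le_cRe_normc z : `|cRe z| <= normc z.
Proof.
by case: z => a b /=; rewrite -sqrtr_sqr ler_wsqrtr // lerDl sqr_ge0.
Qed.

Lemma le_cIm_normc z : `|cIm z| <= normc z.
Proof.
by case: z => a b /=; rewrite -sqrtr_sqr ler_wsqrtr // lerDr sqr_ge0.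
Qed.

Lemma normc_cR (x : R) : normc (cR x) = `|x|.
Proof. by rewrite /= expr0n addr0 sqrtr_sqr. Qed.

Lemma normc_ci_mul (x : R) : normc (ci R * cR x) = `|x|.
Proof.
by rewrite normcM normc_cR /= expr0n /= add0r expr1n sqrtr1 mul1r.
Qed.

Lemma normc_le_ReIm z : normc z <= `|cRe z| + `|cIm z|.
Proof.
case: z => a b; have -> : (Complex a b) = cR a + ci R * cR b.
  by rewrite /cR /ci; simpc.
by apply: le_trans (le_normcD _ _) _; rewrite normc_cR normc_ci_mul /= ; simpc.
Qed.

Lemma normc_eq0 z : (normc z == 0) = (z == 0).
Proof.
apply/eqP/eqP => [/eq0_normc //|->]; exact: normc0.
Qed.

Lemma normcX z n : normc (z ^+ n) = normc z ^+ n.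
Proof.
elim: n => [|n IH]; first by rewrite !expr0 normc1.
by rewrite !exprS normcM IH.
Qed.

Lemma wpowE (lam : R[i]) j t : wpow lam j t = normc ((cR t - lam)^-1) ^+ (2 * j).
Proof. by rewrite /wpow cabs2E -exprVn -normcV -exprM. Qed.

Lemma cReD z w : cRe (z + w) = cRe z + cRe w. Proof. by case: z w => a b [c d]. Qed.
Lemma cImD z w : cIm (z + w) = cIm z + cIm w. Proof. by case: z w => a b [c d]. Qed.
Lemma cReN z : cRe (- z) = - cRe z. Proof. by case: z. Qed.
Lemma cImN z : cIm (- z) = - cIm z. Proof. by case: z. Qed.
Lemma cReM z w : cRe (z * w) = cRe z * cRe w - cIm z * cIm w.
Proof. by case: z w => a b [c d]. Qed.
Lemma cImM z w : cIm (z * w) = cRe z * cIm w + cIm z * cRe w.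
Proof. by case: z w => a b [c d]. Qed.

Definition cmeas f := measurable_fun setT (fun t => cRe (f t)) /\
  measurable_fun setT (fun t => cIm (f t)).

Lemma cmeas_cst z : cmeas (fun=> z).
Proof. by split; exact: measurable_cst. Qed.

Lemma cmeas_cR (h : R -> R) : measurable_fun setT h -> cmeas (fun t => cR (h t)).
Proof. by split=> //; exact: measurable_cst. Qed.

Lemma cmeasD f g : cmeas f -> cmeas g -> cmeas (fun t => f t + g t).
Proof.
move=> [f1 f2] [g1 g2]; split.
- by under eq_fun do rewrite cReD; exact: measurable_funD.
- by under eq_fun do rewrite cImD; exact: measurable_funD.
Qed.

Lemma cmeasN f : cmeas f -> cmeas (fun t => - f t).
Proof.
move=> [f1 f2]; split.
- by under eq_fun do rewrite cReN; exact: measurableT_comp.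
- by under eq_fun do rewrite cImN; exact: measurableT_comp.
Qed.

Lemma cmeasB f g : cmeas f -> cmeas g -> cmeas (fun t => f t - g t).
Proof. by move=> mf mg; apply: cmeasD => //; exact: cmeasN. Qed.

Lemma cmeasM f g : cmeas f -> cmeas g -> cmeas (fun t => f t * g t).
Proof.
move=> [f1 f2] [g1 g2]; split.
- by under eq_fun do rewrite cReM; apply: measurable_funB; exact: measurable_funM.
- by under eq_fun do rewrite cImM; apply: measurable_funD; exact: measurable_funM.
Qed.

Lemma cmeasX f n : cmeas f -> cmeas (fun t => f t ^+ n).
Proof.
move=> mf; elim: n => [|n IH]; first by under eq_fun do rewrite expr0; exact: cmeas_cst.
by under eq_fun do rewrite exprS; exact: cmeasM.
Qed.

Lemma cmeas_horner f (p : {poly R[i]}) : cmeas f -> cmeas (fun t => p.[f t]).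
Proof.
move=> mf; elim/poly_ind: p => [|p c IH].
  by under eq_fun do rewrite horner0; exact: cmeas_cst.
by under eq_fun do rewrite hornerMXaddC; apply: cmeasD (cmeas_cst _); exact: cmeasM.
Qed.

(** On nonnegative arguments, inversion with [0^-1 = 0] is the power of exponent [-1], which is
    measurable. *)
Lemma measurable_inv_ge0 (h : R -> R) : (forall t, 0 <= h t) ->
  measurable_fun setT h -> measurable_fun setT (fun t => (h t)^-1).
Proof.
move=> h0 mh; under eq_fun do rewrite -powR_inv1 //.
exact: (measurableT_comp (measurable_powR (R := R) (-1)) mh).
Qed.

Lemma cmeas_normc f : cmeas f -> measurable_fun setT (fun t => normc (f t)).
Proof.
move=> [f1 f2]; rewrite (_ : (fun t => _) =
  (fun t => (cRe (f t) ^+ 2 + cIm (f t) ^+ 2) `^ 2^-1)).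
  apply: (measurableT_comp (measurable_powR (R := R) 2^-1)).
  by apply: measurable_funD; exact: measurable_funX.
by apply/funext => t; rewrite powR12_sqrt ?addr_ge0 ?sqr_ge0 //; case: (f t).
Qed.

Lemma cmeasV f : cmeas f -> cmeas (fun t => (f t)^-1).
Proof.
move=> mf; have [f1 f2] := mf.
have mV : measurable_fun setT (fun t => (normc (f t) ^+ 2)^-1).
  apply: measurable_inv_ge0 => [t|]; first exact: sqr_ge0.
  by apply: measurable_funX; exact: cmeas_normc.
split.
- rewrite (_ : (fun t => _) = (fun t => cRe (f t) * (normc (f t) ^+ 2)^-1)).
    exact: measurable_funM.
  by apply/funext => t; rewrite -cabs2E; case: (f t).
- rewrite (_ : (fun t => _) = (fun t => - (cIm (f t)) * (normc (f t) ^+ 2)^-1)).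
    by apply: measurable_funM => //; exact: measurableT_comp.
  by apply/funext => t; rewrite -cabs2E; case: (f t) => a b /=; rewrite mulNr.
Qed.

(** * Real and complex integrability *)

Definition rint mu (h : R -> R) : Prop := mu.-integrable setT (EFin \o h).

Lemma rintD mu h k : rint mu h -> rint mu k -> rint mu (fun t => h t + k t).
Proof. by move=> ih ik; exact: (integrableD measurableT ih ik). Qed.

Lemma rintZ mu c h : rint mu h -> rint mu (fun t => c * h t).
Proof. by move=> ih; exact: (integrableZl measurableT c ih). Qed.

Lemma rint_le mu h k : measurable_fun setT h -> rint mu k ->
  (forall t, `|h t| <= k t) -> rint mu h.
Proof.
move=> mh ik hk; apply: (le_integrable measurableT _ _ ik).
  exact/measurable_EFinP.
by move=> t _ /=; rewrite lee_fin (le_trans (hk t)) // ler_norm.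
Qed.

Lemma rintP mu h : measurable_fun setT h -> (forall t, 0 <= h t) ->
  rint mu h <-> (\int[mu]_t (h t)%:E < +oo)%E.
Proof.
move=> mh h0; rewrite /rint; split=> [/integrableP[_]|H].
  by under eq_integral do rewrite /= ger0_norm //.
apply/integrableP; split; first exact/measurable_EFinP.
by under eq_integral do rewrite /= ger0_norm //.
Qed.

Definition cintegrable mu f := rint mu (fun t => cRe (f t)) /\ rint mu (fun t => cIm (f t)).

Lemma cintegrable_le mu f h : cmeas f -> rint mu h -> (forall t, normc (f t) <= h t) ->
  cintegrable mu f.
Proof.
move=> [f1 f2] ih fh; split; apply: rint_le ih _ => // t; apply: le_trans (fh t).
- exact: le_cRe_normc.
- exact: le_cIm_normc.
Qed.

Lemma cintE mu f : cint mu setT f =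
  Complex (\int[mu]_t cRe (f t)) (\int[mu]_t cIm (f t)).
Proof. by rewrite /cint /cR /ci; simpc. Qed.

Lemma cintegrableD mu f g : cintegrable mu f -> cintegrable mu g ->
  cintegrable mu (fun t => f t + g t).
Proof.
move=> [f1 f2] [g1 g2]; split.
- by under eq_fun do rewrite cReD; exact: rintD.
- by under eq_fun do rewrite cImD; exact: rintD.
Qed.

Lemma cintegrableZ mu z f : cintegrable mu f -> cintegrable mu (fun t => z * f t).
Proof.
move=> [f1 f2]; split.
- under eq_fun do rewrite cReM -mulNr.
  by apply: rintD; exact: rintZ.
- under eq_fun do rewrite cImM.
  by apply: rintD; exact: rintZ.
Qed.

Lemma cintegrable0 mu : cintegrable mu (fun=> 0).
Proof.
have h : rint mu (fun=> 0) by exact: integrable0.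
by split.
Qed.

Lemma cint0 mu : cint mu setT (fun=> 0) = 0.
Proof. by rewrite cintE /= !Rintegral_cst // !mul0r. Qed.

Lemma cintD mu f g : cintegrable mu f -> cintegrable mu g ->
  cint mu setT (fun t => f t + g t) = cint mu setT f + cint mu setT g.
Proof.
move=> [f1 f2] [g1 g2]; rewrite !cintE.
under eq_Rintegral do rewrite cReD.
under [X in Complex _ X]eq_Rintegral do rewrite cImD.
by rewrite !RintegralD.
Qed.

Lemma cintZ mu z f : cintegrable mu f ->
  cint mu setT (fun t => z * f t) = z * cint mu setT f.
Proof.
move=> [f1 f2]; rewrite !cintE.
under eq_Rintegral do rewrite cReM.
under [X in Complex _ X]eq_Rintegral do rewrite cImM.
rewrite RintegralB ?RintegralD ?RintegralZl //; try exact: rintZ.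
by case: z.
Qed.

Lemma cintB mu f g : cintegrable mu f -> cintegrable mu g ->
  cint mu setT (fun t => f t - g t) = cint mu setT f - cint mu setT g.
Proof.
move=> fi gi; under eq_fun do rewrite -mulN1r.
by rewrite cintD ?cintZ ?mulN1r //; exact: cintegrableZ.
Qed.

Lemma cintegrableB mu f g : cintegrable mu f -> cintegrable mu g ->
  cintegrable mu (fun t => f t - g t).
Proof.
move=> fi gi; under eq_fun do rewrite -mulN1r.
by apply: cintegrableD => //; exact: cintegrableZ.
Qed.

(** Real and imaginary parts are estimated separately. The resulting factor 2 is harmless: the later
    estimates only concern orders in [h] and [eps]. *)
Lemma normc_cint_le mu f h : cmeas f -> rint mu h ->
  (forall t, normc (f t) <= h t) -> normc (cint mu setT f) <= 2 * \int[mu]_t h t.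
Proof.
move=> mf ih fh; have [f1 f2] := cintegrable_le mf ih fh.
apply: le_trans (normc_le_ReIm _) _; rewrite cintE /= mulr2n mulrDl mul1r.
have ia k : rint mu k -> rint mu (fun t => `|k t|) by exact: integrable_norm.
apply: lerD; (apply: le_trans (le_normr_Rintegral _ _) _ => //);
  apply: le_Rintegral => //; try exact: ia; move=> t _; apply: le_trans (fh t).
- exact: le_cRe_normc.
- exact: le_cIm_normc.
Qed.

(** * Equality almost everywhere and square integrability *)

Lemma aeeq_imp mu f g f' g' : (forall t, f t = g t -> f' t = g' t) ->
  aeeq mu f g -> aeeq mu f' g'.
Proof. by move=> H; apply: negligibleS => t /= N E; apply: N; exact: H. Qed.

Lemma aeeq_imp2 mu f g f' g' f'' g'' :
  (forall t, f t = g t -> f' t = g' t -> f'' t = g'' t) ->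
  aeeq mu f g -> aeeq mu f' g' -> aeeq mu f'' g''.
Proof.
move=> H n1 n2; apply: negligibleS (negligibleU n1 n2) => t /= N.
by apply: contrapT => /not_orP[/contrapT E1 /contrapT E2]; apply: N; exact: H.
Qed.

Lemma aeeq_refl mu f : aeeq mu f f.
Proof. by apply: negligibleS (negligible_set0 mu) => t /=. Qed.

Lemma aeeq_eq mu f g : (forall t, f t = g t) -> aeeq mu f g.
Proof. by move=> /funext ->; exact: aeeq_refl. Qed.

Lemma aeeq_sym mu f g : aeeq mu f g -> aeeq mu g f.
Proof. by apply: aeeq_imp. Qed.

Lemma aeeq_trans mu f g f' : aeeq mu f g -> aeeq mu g f' -> aeeq mu f f'.
Proof. by apply: aeeq_imp2 => t ->. Qed.

Lemma eq_cint_ae mu f g : cmeas f -> cmeas g -> aeeq mu f g ->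
  cint mu setT f = cint mu setT g.
Proof.
move=> [f1 f2] [g1 g2] fg; rewrite !cintE /Rintegral; congr Complex; congr fine;
  apply: ae_eq_integral => //; try exact/measurable_EFinP;
  by apply: negligibleS fg => t /= N E; apply: N => _; rewrite E.
Qed.

Lemma inL2P mu f : inL2 mu f <-> cmeas f /\ rint mu (fun t => normc (f t) ^+ 2).
Proof.
have E : cmeas f -> rint mu (fun t => normc (f t) ^+ 2) <->
    (\int[mu]_t (cabs2 (f t))%:E < +oo)%E.
  move=> mf; have -> : (\int[mu]_t (cabs2 (f t))%:E = \int[mu]_t (normc (f t) ^+ 2)%:E)%E.
    by apply: eq_integral => t _; rewrite cabs2E.
  apply: rintP => [|t]; last exact: sqr_ge0.
  by apply: measurable_funX; exact: cmeas_normc.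
split=> [[f1 f2 H]|[[f1 f2] /E H]]; first by split=> //; exact/E.
by split=> //; exact: H.
Qed.

Lemma inL2_cmeas mu f : inL2 mu f -> cmeas f.
Proof. by move=> /inL2P[]. Qed.

Lemma inL2_le mu f g (K : R) : cmeas g -> (forall t, normc (g t) <= K * normc (f t)) ->
  inL2 mu f -> inL2 mu g.
Proof.
move=> mg gf /inL2P[mf f2]; apply/inL2P; split => //.
apply: rint_le (rintZ (K ^+ 2) f2) _ => [|t].
  by apply: measurable_funX; exact: cmeas_normc.
rewrite ger0_norm ?sqr_ge0 // -exprMn ler_pXn2r ?nnegrE ?normc_ge0 //.
exact: le_trans (normc_ge0 _) (gf t).
Qed.

Lemma inL2Z mu z f : inL2 mu f -> inL2 mu (fun t => z * f t).
Proof.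
move=> fL; apply: (inL2_le (K := normc z) _ _ fL); last by move=> t; rewrite normcM.
by apply: cmeasM (cmeas_cst _) _; exact: inL2_cmeas fL.
Qed.

Lemma inL2D mu f g : inL2 mu f -> inL2 mu g -> inL2 mu (fun t => f t + g t).
Proof.
move=> /inL2P[mf f2] /inL2P[mg g2]; apply/inL2P; split; first exact: cmeasD.
apply: rint_le (rintZ 2 (rintD f2 g2)) _ => [|t].
  by apply: measurable_funX; apply: cmeas_normc; exact: cmeasD.
rewrite ger0_norm ?sqr_ge0 //.
have : normc (f t + g t) ^+ 2 <= (normc (f t) + normc (g t)) ^+ 2.
  by rewrite ler_pXn2r ?nnegrE ?addr_ge0 ?normc_ge0 // le_normcD.
move/le_trans; apply.
have := sqr_ge0 (normc (f t) - normc (g t)); lra.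
Qed.

Lemma inL2B mu f g : inL2 mu f -> inL2 mu g -> inL2 mu (fun t => f t - g t).
Proof.
move=> fL gL; under eq_fun do rewrite -mulN1r.
by apply: inL2D => //; exact: inL2Z.
Qed.

(** Since [inL2] asks for measurability everywhere, which a change on a negligible set can destroy,
    measurability of [g] is assumed separately. *)
Lemma inL2_ae mu f g : cmeas g -> aeeq mu f g -> inL2 mu f -> inL2 mu g.
Proof.
move=> mg fg /inL2P[mf f2]; apply/inL2P; split => //.
have mn (k : R -> R[i]) : cmeas k -> measurable_fun setT (fun t => normc (k t) ^+ 2).
  by move=> mk; apply: measurable_funX; exact: cmeas_normc.
have n0 (k : R -> R[i]) t : 0 <= normc (k t) ^+ 2 by exact: sqr_ge0.
move/(rintP mu (mn _ mf) (n0 f)): f2 => f2; apply/(rintP mu (mn _ mg) (n0 g)).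
congr (_ < _)%E: f2; apply: ae_eq_integral => //; try by apply/measurable_EFinP; exact: mn.
by apply: negligibleS fg => t /= N E; apply: N => _; rewrite E.
Qed.

End ComplexValued.

(** * The resolvent kernel and its moments *)

Section Resolvent.
Variable R : realType.
Implicit Types (lam z w b c : R[i]) (f g : R -> R[i]) (h k : R -> R) (t : R)
  (p q : {poly R[i]}).

Definition res lam t : R[i] := (cR t - lam)^-1.

Definition at_pt lam t : R[i] := (cR t == lam)%:R.

(** One side of a root vector. The resolvent is 0 at [t = lam], so [b] is exactly the value
    there. *)
Definition wfun lam p b t : R[i] := res lam t * p.[res lam t] + b * at_pt lam t.

Lemma cR0 : cR 0 = 0 :> R[i].
Proof. by []. Qed.

Lemma cRM (x y : R) : cR (x * y) = cR x * cR y.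
Proof. exact: (rmorphM (real_complex R)). Qed.

Lemma cRD (x y : R) : cR (x + y) = cR x + cR y.
Proof. exact: (rmorphD (real_complex R)). Qed.

Lemma cR_eq t lam : cR t = lam -> t = cRe lam.
Proof. by move=> <-. Qed.

(** The convention [0^-1 = 0] makes the product 0 instead of 1 at [lam], which the indicator
    records. *)
Lemma resK lam t : (cR t - lam) * res lam t = 1 - at_pt lam t.
Proof.
rewrite /res /at_pt; have [->|tl] := eqVneq (cR t) lam.
  by rewrite subrr mul0r subrr.
by rewrite mulfV ?subr0 ?subr_eq0.
Qed.

Lemma sub_at_pt lam t : (cR t - lam) * at_pt lam t = 0.
Proof.
rewrite /at_pt; case: eqP => [->|_]; first by rewrite subrr mul0r.
by rewrite mulr0.
Qed.

Lemma res_at_pt lam t : res lam t * at_pt lam t = 0.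
Proof.
rewrite /res /at_pt; case: eqP => [->|_]; first by rewrite subrr invr0 mul0r.
by rewrite mulr0.
Qed.

(** Multiplication by [t - lam] cancels one resolvent factor and kills the value [b]. By [resK] the
    constant [c] survives only off [lam], whence the new value [- c] next to the added [c]. *)
Lemma sub_wfun lam p b c t :
  (cR t - lam) * wfun lam (p * 'X + c%:P) b t =
  wfun lam p (- c) t + c.
Proof.
rewrite /wfun mulrDr [_ * (b * _)]mulrCA sub_at_pt mulr0 addr0 mulrA resK hornerMXaddC.
have := res_at_pt lam t; move: (res lam t) (at_pt lam t) p.[res lam t] => u e x ue.
transitivity ((x * u + c) - (u * e) * x - e * c); first by ring.
by rewrite ue; ring.
Qed.

Lemma cmeas_res lam : cmeas (res lam).
Proof. by apply: cmeasV; apply: cmeasB (cmeas_cst _); apply: cmeas_cR. Qed.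

(** The two cases are real and nonreal [lam]; thanks to this, [lam] can stay an arbitrary complex
    number. *)
Lemma level_setE lam : [set t : R | cR t = lam] = [set cRe lam] \/
  [set t : R | cR t = lam] = set0.
Proof.
have [E|E] := eqVneq (cR (cRe lam)) lam; [left|right].
  by apply/seteqP; split=> t /= [] => [<-|->].
by apply/seteqP; split=> t //= tl; move/eqP: E; apply; rewrite -tl.
Qed.

Lemma measurable_level lam : measurable [set t : R | cR t = lam].
Proof. by case: (level_setE lam) => ->. Qed.

Lemma at_ptE lam t : at_pt lam t = cR (\1_[set t : R | cR t = lam] t).
Proof.
rewrite /at_pt indicE; case: eqP => [E|E].
  by rewrite mem_set.
by rewrite memNset.
Qed.

Lemma cmeas_at_pt lam : cmeas (at_pt lam).
Proof.
rewrite (_ : at_pt lam = fun t => cR (\1_[set t : R | cR t = lam] t)).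
  by apply: cmeas_cR; apply: measurable_indic; exact: measurable_level.
by apply/funext => t; exact: at_ptE.
Qed.

Lemma cmeas_wfun lam p b : cmeas (wfun lam p b).
Proof.
apply: cmeasD; apply: cmeasM; try exact: cmeas_res; try exact: cmeas_cst.
- by apply: cmeas_horner; exact: cmeas_res.
- exact: cmeas_at_pt.
Qed.

Lemma one_sqr_gt0 t : 0 < 1 + t ^+ 2.
Proof. by rewrite ltr_pwDl // sqr_ge0. Qed.

Lemma measurable_wt : measurable_fun setT (fun t : R => (1 + t ^+ 2)^-1).
Proof.
apply: measurable_inv_ge0 => [t|]; first by rewrite ltW ?one_sqr_gt0.
by apply: measurable_funD => //; exact: exprn_measurable.
Qed.

Lemma cmeas_kt : cmeas (@kt R).
Proof.
by apply: cmeas_cR; under eq_fun do rewrite addrC; exact: measurable_wt.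
Qed.

Lemma cmeas_ht : cmeas (@ht R).
Proof.
apply: cmeas_cR; apply: measurable_funM => //.
by under eq_fun do rewrite addrC; exact: measurable_wt.
Qed.

(** With this identity the two decompositions in [Tstar_data] combine to [g = t f - c] almost
    everywhere. *)
Lemma kt_ht t : kt t + cR t * ht t = 1.
Proof.
rewrite /kt /ht -cRM -cRD -[RHS]/(cR 1); congr cR.
by field; rewrite addrC gt_eqF ?one_sqr_gt0.
Qed.

Definition fin_pow (mu : {measure set R -> \bar R}) lam (j : nat) :=
  rint mu (fun t => normc (res lam t) ^+ (2 * j)).

Lemma measurable_res_pow lam n : measurable_fun setT (fun t => normc (res lam t) ^+ n).
Proof. by apply: measurable_funX; apply: cmeas_normc; exact: cmeas_res. Qed.

Lemma fin_powP (mu : {measure set R -> \bar R}) lam j :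
  fin_pow mu lam j <-> (\int[mu]_t (wpow lam j t)%:E < +oo)%E.
Proof.
rewrite (_ : (\int[mu]_t (wpow lam j t)%:E =
  \int[mu]_t (normc (res lam t) ^+ (2 * j))%:E)%E); last first.
  by apply: eq_integral => t _; rewrite wpowE.
apply: rintP; first exact: measurable_res_pow.
by move=> t; rewrite exprn_ge0 ?normc_ge0.
Qed.

(* For [j >= 1] the integrand vanishes at [lam] itself, since [0^-1 = 0]. *)
Lemma fin_pow_offP (mu : {measure set R -> \bar R}) lam j : (0 < j)%N ->
  fin_pow mu lam j <->
  (\int[mu]_(t in [set t | (cR t) != lam]) (wpow lam j t)%:E < +oo)%E.
Proof.
move=> j0; rewrite (_ : (\int[mu]_(t in _) (wpow lam j t)%:E =
  \int[mu]_t (wpow lam j t)%:E)%E); first exact: fin_powP.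
rewrite integral_mkcond; apply: eq_integral => t _; rewrite patchE.
case: ifPn => //; rewrite notin_setE /= => /negP; rewrite negbK => /eqP tl.
by rewrite wpowE tl subrr invr0 normc0 expr0n muln_eq0 /= -leqn0 leqNgt j0.
Qed.

(* For [i = 0] the kernel carries the regularising term of [Gamma1] and [Mfun]. *)
Definition rker i lam t : R[i] := res lam t ^+ i.+1 - (i == 0%N)%:R * ht t.

(** Off the real line these are the Taylor coefficients of [Mfun] at [lam]; on it they keep their
    meaning as long as the integrals converge. *)
Definition mom (mu : {measure set R -> \bar R}) (C : R) lam i : R[i] :=
  (i == 0%N)%:R * cR C + cint mu setT (rker i lam).

Definition mass (mu : {measure set R -> \bar R}) lam : R :=
  fine (mu [set t | cR t = lam]).

Lemma cmeas_rker i lam : cmeas (rker i lam).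
Proof.
apply: cmeasB; first by apply: cmeasX; exact: cmeas_res.
by apply: cmeasM (cmeas_cst _) _; exact: cmeas_ht.
Qed.

(** * Consequences of the weight condition for a single measure *)

Section OneMeasure.
Variables (mu : {measure set R -> \bar R}) (hmu : rint mu (fun t => (1 + t ^+ 2)^-1)).

Lemma inL2_ht : inL2 mu (@ht R).
Proof.
apply/inL2P; split; first exact: cmeas_ht.
apply: rint_le hmu _ => [|t].
  by apply: measurable_funX; apply: cmeas_normc; exact: cmeas_ht.
rewrite /ht normc_cR ger0_norm ?sqr_ge0 // real_normK ?num_real // exprMn exprVn.
have w0 := one_sqr_gt0 t; rewrite (addrC (t ^+ 2)) ler_pdivrMr ?exprn_gt0 //.
by rewrite [(1 + _) ^+ 2]expr2 mulKf ?gt_eqF // lerDr.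
Qed.

Lemma inL2_kt : inL2 mu (@kt R).
Proof.
apply/inL2P; split; first exact: cmeas_kt.
apply: rint_le hmu _ => [|t].
  by apply: measurable_funX; apply: cmeas_normc; exact: cmeas_kt.
rewrite /kt normc_cR ger0_norm ?sqr_ge0 // real_normK ?num_real // exprVn.
have w0 := one_sqr_gt0 t; rewrite (addrC (t ^+ 2)) lef_pV2 ?posrE ?exprn_gt0 //.
by rewrite [(1 + _) ^+ 2]expr2 ler_peMl ?(ltW w0) // lerDl sqr_ge0.
Qed.

(** The indicator is at most [(1 + lam^2) / (1 + t^2)], with equality at a real [lam]. In particular
    every atom is finite. *)
Lemma rint_at_pt lam : rint mu (fun t => normc (at_pt lam t)).
Proof.
apply: rint_le (rintZ (1 + cRe lam ^+ 2) hmu) _ => [|t].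
  by apply: cmeas_normc; exact: cmeas_at_pt.
rewrite ger0_norm ?normc_ge0 // /at_pt; case: eqP => [<-|_]; last first.
  by rewrite normc0 mulr_ge0 ?invr_ge0 ?ltW ?one_sqr_gt0.
by rewrite normc1 mulfV ?gt_eqF ?one_sqr_gt0.
Qed.

Lemma cintegrable_at_pt lam : cintegrable mu (at_pt lam).
Proof. by apply: (cintegrable_le (cmeas_at_pt lam) (rint_at_pt lam)). Qed.

Lemma inL2_at_pt lam : inL2 mu (at_pt lam).
Proof.
apply/inL2P; split; first exact: cmeas_at_pt.
rewrite (_ : (fun t => _) = (fun t => normc (at_pt lam t))); first exact: rint_at_pt.
by apply/funext => t; rewrite /at_pt; case: eqP => _; rewrite ?normc1 ?normc0 ?expr1n ?expr0n.
Qed.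

Lemma level_fin lam : (mu [set t | cR t = lam] < +oo)%E.
Proof.
have ml := measurable_level lam.
rewrite -[X in mu X]setIT -(integral_indic _ measurableT ml).
have /(rintP mu (cmeas_normc (cmeas_at_pt lam)) (fun t => normc_ge0 _)) H := rint_at_pt lam.
congr (_ < _)%E: H; apply: eq_integral => t _.
by rewrite at_ptE normc_cR ger0_norm ?indicE.
Qed.

Lemma massE lam : (mass mu lam)%:E = mu [set t | cR t = lam].
Proof. by rewrite fineK // ge0_fin_numE // level_fin. Qed.

Lemma mass_eq0 lam : mass mu lam = 0 <-> mu [set t | cR t = lam] = 0%E.
Proof. by rewrite -massE; split=> [->|[]]. Qed.

Lemma cint_at_pt lam : cint mu setT (at_pt lam) = cR (mass mu lam).
Proof.
rewrite cintE /cR; congr Complex; last first.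
  rewrite -[RHS](@mul0r R (fine (mu setT))) -(Rintegral_cst mu measurableT).
  by apply: eq_Rintegral => t _; rewrite at_ptE.
rewrite /mass /Rintegral; congr fine.
have ml := measurable_level lam.
rewrite -[X in _ = mu X]setIT -(integral_indic _ measurableT ml).
by apply: eq_integral => t _; rewrite at_ptE.
Qed.

Lemma level_negligible lam : mass mu lam = 0 -> mu.-negligible [set t | cR t = lam].
Proof.
by move=> /mass_eq0 m0; exists [set t | cR t = lam]; split=> //; exact: measurable_level.
Qed.

(** A null set cannot contain an atom, so an equality almost everywhere may be evaluated at it. *)
Lemma aeeq_at_lam f g lam : mass mu lam != 0 -> aeeq mu f g ->
  cR (cRe lam) = lam /\ f (cRe lam) = g (cRe lam).
Proof.
move=> m0 [A [mA A0 sA]].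
have [E|E] := level_setE lam; last by move: m0; rewrite /mass E measure0 eqxx.
have rl : cR (cRe lam) = lam.
  by have : [set cRe lam] (cRe lam) by []; rewrite -E.
split=> //; apply: contrapT => N; move/eqP: m0; apply; apply/mass_eq0.
apply: (subset_measure0 (measurable_level lam) mA _ A0) => t /cR_eq ->.
exact: sA.
Qed.

(** Where the resolvent is at most 1 in modulus its square dominates, elsewhere its power [2 n]
    does. *)
Lemma fin_pow_between lam n m : fin_pow mu lam 1 -> fin_pow mu lam n ->
  (2 <= m <= 2 * n)%N -> rint mu (fun t => normc (res lam t) ^+ m).
Proof.
move=> f1 fn /andP[m2 mn]; apply: rint_le (rintD f1 fn) _ => [|t].
  exact: measurable_res_pow.
have u0 := normc_ge0 (res lam t); rewrite ger0_norm ?exprn_ge0 // muln1.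
have [u1|u1] := leP (normc (res lam t)) 1.
  by rewrite ler_wpDr ?exprn_ge0 // ler_wiXn2l.
by rewrite ler_wpDl ?exprn_ge0 // ler_weXn2l // ltW.
Qed.

Lemma inL2_res_pow lam n : fin_pow mu lam n -> inL2 mu (fun t => res lam t ^+ n).
Proof.
move=> fn; apply/inL2P; split; first by apply: cmeasX; exact: cmeas_res.
by under eq_fun do rewrite normcX -exprM mulnC.
Qed.

Lemma fin_pow_inL2 lam n : inL2 mu (fun t => res lam t ^+ n) -> fin_pow mu lam n.
Proof.
move=> /inL2P[_]; rewrite /fin_pow.
by under eq_fun do rewrite normcX -exprM mulnC.
Qed.

(** For [i > 0] the power [i + 1] lies between the integrable powers [2] and [2 (i + 1)]. For
    [i = 0] the regularising term must supply the decay at infinity. *)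
Lemma cintegrable_rker lam i : (forall j, (0 < j <= i.+1)%N -> fin_pow mu lam j) ->
  cintegrable mu (rker i lam).
Proof.
move=> fj; case: i fj => [|i] fj; last first.
  have fi : rint mu (fun t => normc (res lam t) ^+ i.+2).
    apply: (@fin_pow_between lam i.+2); [exact: fj|by apply: fj; rewrite leqnn|].
    by rewrite leq_pmull.
  apply: cintegrable_le fi _; first exact: cmeas_rker.
  by move=> t; rewrite /rker mul0r subr0 normcX.
have f1 : fin_pow mu lam 1 by apply: fj.
pose K := 2 + normc lam.
apply: (cintegrable_le _ (rintZ K (rintD f1 (rintZ 2 hmu)))); first exact: cmeas_rker.
move=> t; rewrite /rker expr1 mul1r muln1.
have w0 := one_sqr_gt0 t; have n0 := normc_ge0 lam; have u0 := normc_ge0 (res lam t).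
have s0 : 0 < (1 + t ^+ 2)^-1 by rewrite invr_gt0.
have nk : normc (kt t) = (1 + t ^+ 2)^-1 by rewrite normc_cR addrC ger0_norm ?ltW.
have Et : ht t = cR t * kt t by rewrite /ht /kt -cRM.
have [tl|tl] := eqVneq (cR t) lam.
  rewrite /res tl subrr invr0 sub0r normcN Et normcM tl nk normc0 expr0n add0r /K.
  nra.
(* The leading terms [1 / t] cancel: the difference is the resolvent times a factor of order
   [1 / t]. *)
have -> : res lam t - ht t = res lam t * ((1 + lam * cR t) * kt t).
  have tl0 : cR t - lam != 0 by rewrite subr_eq0.
  rewrite /res; apply: (mulfI tl0); rewrite mulrBr mulfV // mulVKf //.
  by rewrite -{1}(kt_ht t) Et; ring.
have B : normc (1 + lam * cR t) <= (1 + normc lam) * (1 + `|t|).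
  apply: le_trans (le_normcD _ _) _; rewrite normc1 normcM normc_cR.
  have := normr_ge0 t; nra.
rewrite !normcM nk.
have T2 : `|t| ^+ 2 = t ^+ 2 by rewrite real_normK ?num_real.
have sT : (1 + `|t| ^+ 2) * (1 + t ^+ 2)^-1 = 1 by rewrite T2 mulfV ?gt_eqF.
have := normr_ge0 t; have := normc_ge0 (1 + lam * cR t).
move: (normc (1 + lam * cR t)) (normc (res lam t)) u0 `|t| (1 + t ^+ 2)^-1 s0 sT B.
rewrite /K; move: (normc lam) n0 => L L0 x a a0 T s s0 sT xB x0 T0 {nk w0 T2}.
have xs2 : ((1 + T) * s) ^+ 2 <= 2 * s.
  rewrite exprMn [s ^+ 2]expr2 mulrA ler_wpM2r ?(ltW s0) //.
  have -> : (1 + T) ^+ 2 * s = 2 * ((1 + T ^+ 2) * s) - (1 - T) ^+ 2 * s by ring.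
  by rewrite sT mulr1 gerBl mulr_ge0 ?sqr_ge0 ?(ltW s0).
(* The product of two square integrable factors is split by the inequality of arithmetic and
   geometric means, using [xs2]. *)
have A1 : a * ((1 + T) * s) <= a ^+ 2 + 2 * s.
  by have := sqr_ge0 (a - (1 + T) * s / 2); nra.
have A2 : a * (x * s) <= (1 + L) * (a * ((1 + T) * s)).
  have : 0 <= a * s by rewrite mulr_ge0 // ltW.
  nra.
apply: le_trans A2 _; apply: (@le_trans _ _ ((1 + L) * (a ^+ 2 + 2 * s))).
  by rewrite ler_wpM2l // addr_ge0.
have : 0 <= a ^+ 2 + 2 * s by rewrite addr_ge0 ?sqr_ge0 // mulr_ge0 // ltW.
nra.
Qed.

End OneMeasure.
End Resolvent.

(** * One step of a Jordan chain on one side *)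

Section Step.
Variable R : realType.
Implicit Types (lam z w b c : R[i]) (f g : R -> R[i]) (h k : R -> R) (t : R)
  (p q : {poly R[i]}).
Variables (mu : {measure set R -> \bar R}) (hmu : rint mu (fun t => (1 + t ^+ 2)^-1)).

Lemma cint_sum n (a : nat -> R[i]) (e : nat -> R -> R[i]) :
  (forall i, (i < n)%N -> cintegrable mu (e i)) ->
  cintegrable mu (fun t => \sum_(i < n) a i * e i t) /\
  cint mu setT (fun t => \sum_(i < n) a i * e i t) = \sum_(i < n) a i * cint mu setT (e i).
Proof.
elim: n => [|n IH] ei.
  rewrite (_ : (fun t => _) = fun=> 0); last by apply/funext => t; rewrite big_ord0.
  by rewrite cint0 big_ord0; split=> //; exact: cintegrable0.
have [i1 E1] : _ /\ _ := IH (fun i (Hi : (i < n)%N) => ei i (ltnW Hi)).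
have i2 : cintegrable mu (fun t => a n * e n t) by apply: cintegrableZ; exact: ei.
rewrite (_ : (fun t => _) = fun t => \sum_(i < n) a i * e i t + a n * e n t); last first.
  by apply/funext => t; rewrite big_ord_recr.
split; first exact: cintegrableD.
by rewrite cintD // E1 cintZ ?big_ord_recr //; exact: ei.
Qed.

Lemma wfun_sub_ht lam q b t :
  wfun lam q b t - q`_0 * ht t =
  \sum_(i < size q) q`_i * rker i lam t + b * at_pt lam t.
Proof.
rewrite /wfun addrAC; congr (_ + _); rewrite horner_coef mulr_sumr.
rewrite (_ : q`_0 * ht t = \sum_(i < size q) q`_i * ((i == 0%N :> nat)%:R * ht t)).
  by rewrite -sumrB; apply: eq_bigr => i _; rewrite mulrCA -exprS -mulrBr.
case E: (size q) => [|n].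
  by rewrite big_ord0 nth_default ?E // mul0r.
by rewrite big_ord_recl /= mul1r big1 ?addr0 // => i _; rewrite mul0r mulr0.
Qed.

(** Only the term of index 0 needs regularising, and subtracting [q_0 ht] does precisely that;
    linearity of the integral gives the rest. *)
Lemma Gamma1_wfun (C : R) lam q b :
  (forall j, (0 < j <= size q)%N -> fin_pow mu lam j) ->
  Gamma1 mu C (fun t => wfun lam q b t - q`_0 * ht t) q`_0 =
  b * cR (mass mu lam) + \sum_(i < size q) q`_i * mom mu C lam i.
Proof.
move=> fq; rewrite /Gamma1; under eq_fun do rewrite wfun_sub_ht.
have [|I1 E1] := @cint_sum (size q) (fun i => q`_i) (fun i => rker i lam).
  move=> i iq; apply: cintegrable_rker => // j /andP[j0 ji]; apply: fq.
  by rewrite j0 (leq_trans ji).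
have ia := cintegrable_at_pt hmu lam.
rewrite cintD //; last exact: cintegrableZ.
rewrite E1 cintZ // cint_at_pt addrA addrC; congr (_ + _).
rewrite [in RHS](eq_bigr (fun i : 'I_(size q) => q`_i * ((i == 0%N :> nat)%:R * cR C) +
  q`_i * cint mu setT (rker i lam))); last by move=> i _; rewrite /mom mulrDr.
rewrite big_split /=; congr (_ + _).
case E: (size q) => [|n].
  by rewrite big_ord0 nth_default ?E // mul0r.
by rewrite big_ord_recl /= mul1r big1 ?addr0 // => i _; rewrite mul0r mulr0.
Qed.

Lemma size_MXaddC_le p c : (size p <= size (p * 'X + c%:P)%R)%N.
Proof.
rewrite size_MXaddC; case: ifP => // /andP[/eqP-> _]; by rewrite size_poly0.
Qed.

Lemma coef0_MXaddC p c : (p * 'X + c%:P)`_0 = c.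
Proof. by rewrite coefD coefMX coefC /= add0r. Qed.

(** By [kt_ht], [g = t f - c] almost everywhere, which turns the relation [g - lam f = w] into a
    multiplication equation for [f]. *)
Lemma Tstar_eq lam f g fQ c (w : R -> R[i]) : Tstar_data mu f g fQ c ->
  aeeq mu (fun t => g t - lam * f t) w ->
  aeeq mu (fun t => (cR t - lam) * f t) (fun t => w t + c).
Proof.
move=> [_ Ef Eg] /(aeeq_imp2 _ (aeeq_imp2 (f'' := fun t => g t + c)
  (g'' := fun t => cR t * f t) _ Ef Eg)); apply.
- move=> t E1 E2; rewrite mulrBl -E1 addrAC E2 //.
- move=> t -> ->; rewrite mulrDr -addrA; congr (_ + _).
  by rewrite -[in X in _ + X](mulr1 c) -(kt_ht t); ring.
Qed.

(** All lower powers of the resolvent and the indicator are square integrable already; subtracting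
    them isolates the leading power. *)
Lemma inL2_lead_wfun lam q b : inL2 mu (wfun lam q b) -> q != 0 ->
  (forall j, (0 < j < size q)%N -> fin_pow mu lam j) -> fin_pow mu lam (size q).
Proof.
move=> H q0 fq; apply: fin_pow_inL2.
have sq : size q = (size q).-1.+1 by rewrite prednK // lt0n size_poly_eq0.
have L n : (n <= (size q).-1)%N ->
    inL2 mu (fun t => \sum_(i < n) q`_i * res lam t ^+ i.+1).
  elim: n => [|n IH] nq.
    under eq_fun do rewrite big_ord0.
    by have := inL2Z 0 H; under eq_fun do rewrite mul0r.
  under eq_fun do rewrite big_ord_recr /=.
  apply: inL2D; first exact: IH (ltnW nq).
  by apply: inL2Z; apply: inL2_res_pow; apply: fq; rewrite sq ltnS.
have := inL2Z (lead_coef q)^-1 (inL2B (inL2B H (inL2Z b (inL2_at_pt hmu lam))) (L _ (leqnn _))).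
congr (inL2 _ _); apply/funext => t; rewrite /wfun addrK horner_coef mulr_sumr.
rewrite (eq_bigr (fun i : 'I_(size q) => q`_i * res lam t ^+ i.+1)); last first.
  by move=> i _; rewrite mulrCA -exprS.
have -> : \sum_(i < size q) q`_i * res lam t ^+ i.+1 =
    \sum_(i < (size q).-1) q`_i * res lam t ^+ i.+1 + lead_coef q * res lam t ^+ size q.
  by rewrite /lead_coef; case: (size q) sq => // n _; rewrite big_ord_recr.
by rewrite addrAC subrr add0r mulKf // lead_coef_eq0.
Qed.

(** Dividing [(t - lam) f = w + c] by [t - lam] determines [f] off [lam]; at an atom the same
    equation constrains [w] instead. Square integrability of [f] then yields the new finite
    moment. *)
Lemma Tstar_step C lam f g fQ c p b :
  (forall j, (0 < j <= size p)%N -> fin_pow mu lam j) ->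
  aeeq mu (fun t => g t - lam * f t) (wfun lam p b) ->
  Tstar_data mu f g fQ c ->
  let q := p * 'X + c%:P in
  exists b', [/\ aeeq mu f (wfun lam q b'), (mass mu lam != 0 -> b = - c),
    (forall j, (0 < j <= size q)%N -> fin_pow mu lam j) &
    Gamma1 mu C fQ c = b' * cR (mass mu lam) + \sum_(i < size q) q`_i * mom mu C lam i].
Proof.
move=> fp Ew Td q; have Et := Tstar_eq Td Ew; have [[L1 _] Ef _] := Td.
(* The equation says nothing about [f] at [lam], so this value is a free parameter read off from
   [f]. *)
exists (f (cRe lam)).
have E1 : aeeq mu f (wfun lam q (f (cRe lam))).
  apply: aeeq_imp Et => t; have [tl _|tl E] := eqVneq (cR t) lam.
    by rewrite /wfun /at_pt /res tl eqxx subrr invr0 mul0r add0r mulr1 -(cR_eq tl).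
  have tl0 : cR t - lam != 0 by rewrite subr_eq0.
  by apply: (mulfI tl0); rewrite E sub_wfun /wfun /at_pt (negbTE tl) !mulr0.
have Lw : inL2 mu (wfun lam q (f (cRe lam))).
  apply: inL2_ae (cmeas_wfun _ _ _) (aeeq_trans (aeeq_sym Ef) E1) _.
  by apply: inL2D => //; apply: inL2Z; exact: inL2_ht.
have fq : forall j, (0 < j <= size q)%N -> fin_pow mu lam j.
  have [q0|q0] := eqVneq q 0.
    by move=> j; rewrite q0 size_poly0 leqn0 => /andP[/[swap] /eqP ->].
  (* The polynomial [q] has at most one more coefficient than [p], so only the top exponent is
     new. *)
  have fq' : forall j, (0 < j < size q)%N -> fin_pow mu lam j.
    move=> j /andP[j0 jq]; apply: fp; rewrite j0 /=.
    move: jq; rewrite /q size_MXaddC; case: ifP => // _; by rewrite ltnS.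
  move=> j /andP[j0]; rewrite leq_eqVlt => /orP[/eqP->|jq].
    exact: inL2_lead_wfun Lw q0 fq'.
  by apply: fq'; rewrite j0.
split => //.
- move=> m0; have [rl] := aeeq_at_lam hmu m0 Et.
  rewrite rl subrr mul0r /wfun /at_pt /res rl subrr eqxx invr0 mul0r add0r mulr1.
  by move=> /esym/eqP; rewrite addr_eq0 => /eqP.
- rewrite -Gamma1_wfun // /Gamma1 coef0_MXaddC; congr (_ + _).
  apply: eq_cint_ae; first exact: inL2_cmeas L1.
    apply: cmeasB; first exact: cmeas_wfun.
    by apply: cmeasM (cmeas_cst _) _; exact: cmeas_ht.
  by apply: aeeq_imp2 Ef E1 => t -> /= <-; rewrite addrK.
Qed.

Lemma inL2_wfun lam q b : (forall j, (0 < j <= size q)%N -> fin_pow mu lam j) ->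
  inL2 mu (wfun lam q b).
Proof.
move=> fq; have La := inL2_at_pt hmu lam.
suff H n : (n <= size q)%N -> inL2 mu (fun t => \sum_(i < n) q`_i * res lam t ^+ i.+1).
  rewrite (_ : wfun lam q b = fun t => \sum_(i < size q) q`_i * res lam t ^+ i.+1 +
    b * at_pt lam t); first by apply: inL2D (H _ (leqnn _)) _; exact: inL2Z.
  apply/funext => t; rewrite /wfun horner_coef mulr_sumr; congr (_ + _).
  by apply: eq_bigr => i _; rewrite mulrCA -exprS.
elim: n => [|n IH] nq.
  under eq_fun do rewrite big_ord0.
  by have := inL2Z 0 La; under eq_fun do rewrite mul0r.
under eq_fun do rewrite big_ord_recr /=.
apply: inL2D; first exact: IH (ltnW nq).
by apply: inL2Z; apply: inL2_res_pow; apply: fq.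
Qed.

(** Converse of [Tstar_step]. That [t f_Q] is square integrable is seen from its other expression
    [g + c kt]. *)
Lemma Tstar_wfun lam p b b' c :
  let q := p * 'X + c%:P in
  (forall j, (0 < j <= size q)%N -> fin_pow mu lam j) ->
  (mass mu lam != 0 -> b = - c) ->
  Tstar_data mu (wfun lam q b') (fun t => wfun lam p b t + lam * wfun lam q b' t)
    (fun t => wfun lam q b' t - c * ht t) c.
Proof.
move=> q fq bc.
have Lq := inL2_wfun b' fq; have Lh := inL2_ht hmu; have Lk := inL2_kt hmu.
have Lp : inL2 mu (wfun lam p b).
  apply: inL2_wfun => j /andP[j0 jp]; apply: fq; rewrite j0 /=.
  exact: leq_trans jp (size_MXaddC_le _ _).
have Eae : aeeq mu (fun t => wfun lam p b t + lam * wfun lam q b' t)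
   (fun t => cR t * (wfun lam q b' t - c * ht t) - c * kt t).
  have X t : wfun lam p (- c) t + lam * wfun lam q b' t =
     cR t * (wfun lam q b' t - c * ht t) - c * kt t.
    rewrite -[LHS](addrK c) -[in X in _ - X](mulr1 c) -(kt_ht t).
    have := sub_wfun lam p b' c t; rewrite -/q => /(congr1 (fun x => x - c)).
    by rewrite addrK => <-; ring.
  (* Identity [X] has the value [- c] where [b] is wanted. They agree at an atom by [bc], and
     otherwise differ only on a null set. *)
  have [m0|m0] := eqVneq (mass mu lam) 0; last by apply: aeeq_eq => t; rewrite bc.
  apply: negligibleS (level_negligible hmu m0) => t /= N; apply: contrapT => tl.
  apply: N; rewrite -X; congr (_ + _); rewrite /wfun /at_pt.
  by move/eqP/negbTE: tl => ->; rewrite !mulr0.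
split => //; last by apply: aeeq_eq => t; rewrite subrK.
have Lf : inL2 mu (fun t => wfun lam q b' t - c * ht t) by apply: inL2B => //; exact: inL2Z.
split => //.
apply: (inL2_ae (f := fun t => (wfun lam p b t + lam * wfun lam q b' t) + c * kt t)).
- apply: cmeasM; first exact: cmeas_cR.
  exact: inL2_cmeas Lf.
- by apply: aeeq_imp Eae => t ->; rewrite subrK.
- by apply: inL2D; [apply: inL2D|]; try apply: inL2Z.
Qed.

End Step.

(** * Linear independence and dimension bounds *)

Section Independence.
Variable R : realType.
Implicit Types (lam z b c : R[i]) (f g : R -> R[i]) (t : R) (p q : {poly R[i]}).
Variables (mu : {measure set R -> \bar R}) (hmu : rint mu (fun t => (1 + t ^+ 2)^-1)).

Lemma finite_level_measure (s : seq R[i]) :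
  measurable [set t : R | cR t \in s] /\ (mu [set t : R | cR t \in s] < +oo)%E.
Proof.
elim: s => [|z s [ms fs]].
  rewrite (_ : [set _ | _] = set0); first by rewrite measure0.
  by apply/seteqP; split.
have -> : [set t : R | cR t \in z :: s] = [set t | cR t = z] `|` [set t | cR t \in s].
  apply/seteqP; split=> t /=; rewrite inE; first by case/orP => [/eqP|]; [left|right].
  by case=> [->|->]; rewrite ?eqxx ?orbT.
have mz := measurable_level z; split; first exact: measurableU.
apply: le_lt_trans (measureU2 mu mz ms) _.
by rewrite lte_add_pinfty //; exact: level_fin.
Qed.

(* Off a finite set of points a nonzero [p] does not vanish at the resolvent,
   and finite sets have finite measure. *)
Lemma wfun_ae0 lam p b : mu setT = +oo%E ->
  aeeq mu (wfun lam p b) (fun=> 0) -> p = 0.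
Proof.
move=> moo [A [mA A0 sA]]; apply/eqP; apply: contraT => p0.
have [r pr] := closed_field_poly_normal p.
pose s := lam :: [seq lam + z^-1 | z <- r].
have [ms fs] := finite_level_measure s.
have : (mu setT <= mu (A `|` [set t : R | cR t \in s]))%E.
  apply: le_measure; rewrite ?inE //; first exact: measurableU.
  move=> t _; have [tl|tl] := eqVneq (cR t) lam.
    by right; rewrite /= tl inE eqxx.
  have [W|W] := eqVneq (wfun lam p b t) 0; last by left; apply: sA => /= E; rewrite E eqxx in W.
  right; rewrite /= inE; apply/orP; right.
  have tl0 : cR t - lam != 0 by rewrite subr_eq0.
  have : root p (res lam t).
    move: W; rewrite /wfun /at_pt (negbTE tl) mulr0 addr0 => /eqP.
    by rewrite mulf_eq0 invr_eq0 (negbTE tl0).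
  rewrite pr rootZ ?lead_coef_eq0 // root_prod_XsubC => zr.
  by apply/mapP; exists (res lam t) => //; rewrite /res invrK addrC subrK.
rewrite leNgt => /negP; case; rewrite moo; apply: le_lt_trans fs.
by rewrite -[leRHS]add0e -A0; exact: (measureU2 mu mA ms).
Qed.

Lemma at_pt_ae0 lam b : mass mu lam != 0 ->
  aeeq mu (fun t => b * at_pt lam t) (fun=> 0) -> b = 0.
Proof.
move=> m0 /(aeeq_at_lam hmu m0)[rl].
by rewrite /at_pt rl eqxx mulr1.
Qed.

Lemma wfun_massless lam p b b' : mass mu lam = 0 ->
  aeeq mu (wfun lam p b) (wfun lam p b').
Proof.
move=> m0; apply: negligibleS (level_negligible hmu m0) => t /= N.
apply: contrapT => tl; apply: N; rewrite /wfun /at_pt.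
by move/eqP/negbTE: tl => ->; rewrite !mulr0.
Qed.

Lemma aeeq_sum n (f g : 'I_n -> R -> R[i]) : (forall i, aeeq mu (f i) (g i)) ->
  aeeq mu (fun t => \sum_(i < n) f i t) (fun t => \sum_(i < n) g i t).
Proof.
elim: n f g => [|n IH] f g fg; first by apply: aeeq_eq => t; rewrite !big_ord0.
have H := IH _ _ (fun i => fg (widen_ord (leqnSn n) i)).
by apply: aeeq_imp2 H (fg ord_max) => t E1 E2; rewrite !big_ord_recr /= E1 E2.
Qed.

End Independence.

Section Dimension.
Variable R : realType.
Variables (mup mum : {measure set R -> \bar R}).

(** The coefficients of [n] vectors form a matrix with more rows than columns; a nonzero row of its
    left kernel is a linear dependence. *)
Lemma dim_le (S : set (vec R)) d n (e : 'I_d -> vec R) : (d < n)%N ->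
  (forall v, S v -> exists x : 'I_d -> R[i],
     aeeq mup v.1 (fun t => \sum_(j < d) x j * (e j).1 t) /\
     aeeq mum v.2 (fun t => \sum_(j < d) x j * (e j).2 t)) ->
  ~ dim_ge mup mum S n.
Proof.
move=> dn spanS [v [Sv iv]].
have {spanS Sv} /choice[x xP] : forall i, exists x : 'I_d -> R[i],
     aeeq mup (v i).1 (fun t => \sum_(j < d) x j * (e j).1 t) /\
     aeeq mum (v i).2 (fun t => \sum_(j < d) x j * (e j).2 t).
  by move=> i; exact: spanS.
pose A : 'M[R[i]]_(n, d) := \matrix_(i, j) x i j.
have kn0 : kermx A != 0.
  rewrite -mxrank_eq0 mxrank_ker -lt0n subn_gt0.
  exact: leq_ltn_trans (rank_leq_col A) dn.
pose a := nz_row (kermx A).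
have a0 : a != 0 by rewrite nz_row_eq0.
have aA : a *m A = 0 by apply/sub_kermxP; exact: nz_row_sub.
have aE j : \sum_(i < n) a 0 i * x i j = 0.
  transitivity ((a *m A) 0 j); last by rewrite aA mxE.
  by rewrite mxE; apply: eq_bigr => i _; rewrite mxE.
have Z (mu : {measure set R -> \bar R}) (vv : 'I_n -> R -> R[i]) (ee : 'I_d -> R -> R[i]) :
    (forall i, aeeq mu (vv i) (fun t => \sum_(j < d) x i j * ee j t)) ->
    aezero mu (fun t => \sum_(i < n) a 0 i * vv i t).
  move=> H; have H' i : aeeq mu (fun t => a 0 i * vv i t)
      (fun t => a 0 i * \sum_(j < d) x i j * ee j t).
    by apply: aeeq_imp (H i) => t ->.
  apply: aeeq_imp (aeeq_sum H') => t ->.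
  transitivity (\sum_(j < d) (\sum_(i < n) a 0 i * x i j) * ee j t).
    rewrite -(eq_bigr _ (fun i _ => esym (mulr_sumr _ _ _ _))) exchange_big /=.
    apply: eq_bigr => j _; rewrite mulr_suml; apply: eq_bigr => i _; by rewrite mulrA.
  by rewrite big1 // => j _; rewrite aE mul0r.
have a00 := iv (fun i => a 0 i) (conj
  (Z mup (fun i => (v i).1) (fun j => (e j).1) (fun i => (xP i).1))
  (Z mum (fun i => (v i).2) (fun j => (e j).2) (fun i => (xP i).2))).
by move/eqP: a0; apply; apply/rowP => i; rewrite a00 mxE.
Qed.

End Dimension.

(** * Root vectors of the coupled operator *)

Section RootVectors.
Variable R : realType.
Implicit Types (b c : R[i]) (t : R) (p q : {poly R[i]}).
Variables (mup mum : {measure set R -> \bar R}) (Cp Cm : R) (lam : R[i]).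
Hypothesis hp : rint mup (fun t => (1 + t ^+ 2)^-1).
Hypothesis hm : rint mum (fun t => (1 + t ^+ 2)^-1).

Definition mdiff i : R[i] := mom mup Cp lam i - mom mum Cm lam i.

Definition fins n := forall j, (0 < j <= n)%N -> fin_pow mup lam j /\ fin_pow mum lam j.

Definition wvec p bp bm : vec R := (wfun lam p bp, wfun lam p bm).

Definition is_wvec (v : vec R) p bp bm :=
  aeeq mup v.1 (wfun lam p bp) /\ aeeq mum v.2 (wfun lam p bm).

(** Equality of the two [Gamma1] values for [wvec p bp bm], brought to one side. *)
Definition coupled p bp bm :=
  bp * cR (mass mup lam) - bm * cR (mass mum lam) + \sum_(i < size p) p`_i * mdiff i = 0.

(* The equation [(t - lam) f = w + c] read at an atom [t = lam]. *)
Definition step_ok c bp bm :=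
  (mass mup lam != 0 -> bp = - c) /\ (mass mum lam != 0 -> bm = - c).

Lemma fins_le m n : (m <= n)%N -> fins n -> fins m.
Proof. by move=> mn fn j /andP[j0 jm]; apply: fn; rewrite j0 (leq_trans jm). Qed.

Lemma coupledE p bp bm : coupled p bp bm <->
  bp * cR (mass mup lam) + \sum_(i < size p) p`_i * mom mup Cp lam i =
  bm * cR (mass mum lam) + \sum_(i < size p) p`_i * mom mum Cm lam i.
Proof.
rewrite /coupled (eq_bigr (fun i : 'I_(size p) => p`_i * mom mup Cp lam i -
  p`_i * mom mum Cm lam i)); last by move=> i _; rewrite mulrBr.
rewrite sumrB; move: (\sum_(_ < _) _) (\sum_(_ < _) _) => x y.
split=> [H|E]; last by rewrite addrACA E -opprD subrr.
by apply/eqP; rewrite -subr_eq0 opprD addrACA H.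
Qed.

Lemma sum_mdiff_lead p : (forall i, (i < (size p).-1)%N -> mdiff i = 0) ->
  \sum_(i < size p) p`_i * mdiff i = lead_coef p * mdiff (size p).-1.
Proof.
rewrite /lead_coef; case E: (size p) => [|n] H.
  by rewrite big_ord0 nth_default ?E // mul0r.
rewrite big_ord_recr /= big1 ?add0r // => i _.
by rewrite H ?mulr0 //=.
Qed.

(** Equality of the [Gamma_0] values makes [c], and therefore the whole polynomial, common to both
    sides; only the values at [lam] may differ. *)
Lemma Ahat_step (f g : vec R) p bp bm : fins (size p) ->
  Ahat_graph mup Cp mum Cm f g -> is_wvec (vsub g (vscale lam f)) p bp bm ->
  exists c bp' bm', [/\ is_wvec f (p * 'X + c%:P) bp' bm', step_ok c bp bm,
    fins (size (p * 'X + c%:P)%R) & coupled (p * 'X + c%:P) bp' bm'].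
Proof.
move=> fp [fQp [fQm [cp [cm [Tp Tm Ec EG]]]]] [wp wm]; subst cm; exists cp.
have [bp' [E1 bE1 f1 G1]] := Tstar_step hp Cp (fun j Hj => (fp j Hj).1) wp Tp.
have [bm' [E2 bE2 f2 G2]] := Tstar_step hm Cm (fun j Hj => (fp j Hj).2) wm Tm.
exists bp', bm'; split => //.
- by move=> j Hj; split; [exact: f1|exact: f2].
- by apply/coupledE; rewrite -G1 -G2.
Qed.

Lemma Ahat_wvec p bp bm c bp' bm' : let q := p * 'X + c%:P in
  fins (size q) -> step_ok c bp bm -> coupled q bp' bm' ->
  exists g, Ahat_graph mup Cp mum Cm (wvec q bp' bm') g /\
    wvec p bp bm = vsub g (vscale lam (wvec q bp' bm')).
Proof.
move=> q fq [okp okm] cq.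
exists (fun t => wfun lam p bp t + lam * wfun lam q bp' t,
        fun t => wfun lam p bm t + lam * wfun lam q bm' t).
split; last by congr pair; apply/funext => t /=; rewrite addrK.
have fqp := fun j Hj => (fq j Hj).1; have fqm := fun j Hj => (fq j Hj).2.
exists (fun t => wfun lam q bp' t - c * ht t), (fun t => wfun lam q bm' t - c * ht t), c, c.
split => //; [exact: (Tstar_wfun hp)|exact: (Tstar_wfun hm)|].
have := Gamma1_wfun hp Cp bp' fqp; have := Gamma1_wfun hm Cm bm' fqm.
rewrite /q !coef0_MXaddC -/q => -> ->; exact/coupledE.
Qed.

Lemma wfun00 : wfun lam 0 0 = (fun=> 0).
Proof. by apply/funext => t; rewrite /wfun horner0 mulr0 mul0r addr0. Qed.

Lemma wvec0 : wvec 0 0 0 = (fun=> 0, fun=> 0).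
Proof. by rewrite /wvec wfun00. Qed.

Lemma is_wvec0 v : vzero mup mum v <-> is_wvec v 0 0 0.
Proof. by rewrite /is_wvec wfun00. Qed.

Lemma fins0 : fins 0.
Proof. by move=> j /andP[/[swap]]; rewrite leqn0 => /eqP ->. Qed.

(** A chain is traversed backwards, from the null vector at index [n] up to [f] at index 0. Each
    [Ahat_step] appends a coefficient, so an invariant of these steps holds for every root
    vector. *)
Lemma root_vector_ind (P : {poly R[i]} -> R[i] -> R[i] -> Prop) :
  P 0 0 0 ->
  (forall p bp bm c bp' bm', P p bp bm -> step_ok c bp bm ->
     fins (size (p * 'X + c%:P)%R) -> coupled (p * 'X + c%:P) bp' bm' ->
     P (p * 'X + c%:P) bp' bm') ->
  forall n f, in_ker_pow mup Cp mum Cm lam n f ->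
  exists p bp bm, [/\ is_wvec f p bp bm, fins (size p) & P p bp bm].
Proof.
move=> P0 PS n f [ch [<- chS chn]].
suff H k : (k <= n)%N -> exists p bp bm,
    [/\ is_wvec (ch (n - k)%N) p bp bm, fins (size p) & P p bp bm].
  by have := H n (leqnn n); rewrite subnn.
elim: k => [_|k IH kn].
  exists 0, 0, 0; rewrite subn0 size_poly0; split=> //; last exact: fins0.
  exact/is_wvec0.
have [p [bp [bm [wv fp Pp]]]] := IH (ltnW kn).
have nk : (n - k.+1 < n)%N by rewrite ltn_subrL /= (leq_trans _ kn).
have [g [Ag]] := chS _ nk; rewrite subnSK // => E; rewrite E in wv.
have [c [bp' [bm' [w' ok' fq cq]]]] := Ahat_step fp Ag wv.
by exists (p * 'X + c%:P), bp', bm'; split => //; exact: PS ok' fq cq.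
Qed.

(** States are numbered upwards from zero while a chain descends to zero, hence the reversal
    [m - k]. *)
Lemma wvec_in_ker (p : nat -> {poly R[i]}) (bp bm c : nat -> R[i]) n :
  p 0%N = 0 -> bp 0%N = 0 -> bm 0%N = 0 ->
  (forall k, (k < n)%N -> [/\ p k.+1 = p k * 'X + (c k)%:P, step_ok (c k) (bp k) (bm k),
     fins (size (p k.+1)) & coupled (p k.+1) (bp k.+1) (bm k.+1)]) ->
  forall m, (m <= n)%N -> in_ker_pow mup Cp mum Cm lam m (wvec (p m) (bp m) (bm m)).
Proof.
move=> p0 bp0 bm0 H m mn; exists (fun k => wvec (p (m - k)%N) (bp (m - k)%N) (bm (m - k)%N)).
split; first by rewrite subn0.
- move=> k km; rewrite -(subnSK km).
  have [|E ok fq cq] := H (m - k.+1)%N.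
    by rewrite (leq_trans _ mn) // ltn_subrL /= (leq_trans _ km).
  rewrite E in fq cq *; exact: Ahat_wvec.
- by rewrite subnn p0 bp0 bm0 wvec0; split; exact: aeeq_refl.
Qed.

Lemma sum_wfun n (a : 'I_n -> R[i]) (p : 'I_n -> {poly R[i]}) (b : 'I_n -> R[i]) t :
  \sum_(i < n) a i * wfun lam (p i) (b i) t =
  wfun lam (\sum_(i < n) a i *: p i) (\sum_(i < n) a i * b i) t.
Proof.
rewrite /wfun horner_sum mulr_sumr mulr_suml -big_split; apply: eq_bigr => i _ /=.
by rewrite hornerZ; ring.
Qed.

(** This is a single step from the zero state; its condition [step_ok c 0 0] forces [c = 0] as soon
    as one side has an atom. *)
Lemma eigen_form f : in_ker_pow mup Cp mum Cm lam 1 f ->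
  exists c bp bm, [/\ is_wvec f c%:P bp bm, step_ok c 0 0,
    fins (size (c%:P : {poly R[i]})) & coupled c%:P bp bm].
Proof.
move=> [ch [<- chS ch1]]; have [g [Ag E]] := chS 0%N isT.
rewrite E in ch1; move/is_wvec0: ch1 => w0.
have f0 : fins (size (0 : {poly R[i]})) by rewrite size_poly0; exact: fins0.
have [c [bp [bm]]] := Ahat_step f0 Ag w0; rewrite mul0r add0r => H.
by exists c, bp, bm.
Qed.

Lemma sigma_pA_eigen : sigma_pA mup Cp mum Cm lam ->
  exists f, ~ vzero mup mum f /\ in_ker_pow mup Cp mum Cm lam 1 f.
Proof.
move=> [f [fn0 Af]]; exists f; split => //.
exists (fun k => if k is 0 then f else (fun=> 0, fun=> 0)); split => //.
- move=> [|//] _; exists (vscale lam f); split=> //.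
  by congr pair; apply/funext => t /=; rewrite subrr.
- by split; exact: aeeq_refl.
Qed.

Lemma wvec_sigma_pA c bp bm : fins (size (c%:P : {poly R[i]})) -> step_ok c 0 0 ->
  coupled c%:P bp bm -> ~ vzero mup mum (wvec c%:P bp bm) -> sigma_pA mup Cp mum Cm lam.
Proof.
move=> fc ok cc n0; exists (wvec c%:P bp bm); split => //.
have := @Ahat_wvec 0 0 0 c bp bm; rewrite mul0r add0r => /(_ fc ok cc)[g [Ag]].
rewrite wvec0 => -[E1 E2]; move: Ag; congr (Ahat_graph _ _ _ _ _ _).
case: g E1 E2 => g1 g2 /= E1 E2; congr pair; apply/funext => t; apply/eqP; rewrite -subr_eq0.
- by rewrite -(congr1 (fun h => h t) E1).
- by rewrite -(congr1 (fun h => h t) E2).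
Qed.

Lemma eigenspace_dim_ge1 : sigma_pA mup Cp mum Cm lam ->
  dim_ge mup mum (Defs.eigenspace mup Cp mum Cm lam) 1.
Proof.
move=> /sigma_pA_eigen[f [fn0 kf]]; exists (fun=> f); split=> // a [a1 a2] i.
apply: contrapT => ai0; apply: fn0; rewrite ord1 in ai0; move/eqP: ai0 => ai0.
split; [apply: aeeq_imp a1|apply: aeeq_imp a2] => t /=; rewrite big_ord1 => /eqP;
  by rewrite mulf_eq0 (negbTE ai0) => /eqP.
Qed.

(** Once [c = 0], the coupling is an equality of the two atomic terms. If one mass vanishes both
    terms do, and then each side is null. *)
Lemma no_eigenvalue : (forall c bp bm, step_ok c 0 0 ->
    fins (size (c%:P : {poly R[i]})) -> coupled c%:P bp bm -> c = 0) ->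
  mass mup lam = 0 \/ mass mum lam = 0 -> ~ sigma_pA mup Cp mum Cm lam.
Proof.
move=> Hc m0 /sigma_pA_eigen[f [fn0 /eigen_form[c [bp [bm [[w1 w2] ok fc cc]]]]]].
have c0 := Hc _ _ _ ok fc cc; apply: fn0; apply/is_wvec0; subst c.
rewrite polyC0 in w1 w2 cc; move: cc; rewrite /coupled size_poly0 big_ord0 addr0 => cc.
have {cc} [E1 E2] : bp * cR (mass mup lam) = 0 /\ bm * cR (mass mum lam) = 0.
  case: m0 => m0; rewrite m0 cR0 !mulr0 in cc *; split=> //.
    by apply/eqP; rewrite -oppr_eq0 -[- _]sub0r cc.
  by rewrite subr0 in cc.
have X (mu : {measure set R -> \bar R}) (hmu : rint mu (fun t => (1 + t ^+ 2)^-1)) b :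
    b * cR (mass mu lam) = 0 -> aeeq mu (wfun lam 0 b) (wfun lam 0 0).
  move=> /eqP; rewrite mulf_eq0 => /orP[/eqP->|m]; first exact: aeeq_refl.
  by apply: wfun_massless => //; move/eqP: m => [].
split; [exact: aeeq_trans w1 (X _ hp _ E1)|exact: aeeq_trans w2 (X _ hm _ E2)].
Qed.

Lemma first_failure (G : nat -> Prop) d0 n : G d0 -> (d0 <= n)%N -> ~ G n ->
  exists2 d, (d0 <= d < n)%N & G d /\ ~ G d.+1.
Proof.
move=> G0; elim: n => [|n IH] dn nG.
  by move: dn nG; rewrite leqn0 => /eqP <-.
have [Gn|nGn] := pselect (G n).
  exists n => //; rewrite leqnn andbT -ltnS ltn_neqAle dn andbT.
  by apply/eqP => E; apply: nG; rewrite -E.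
have [|d /andP[d1 d2] Hd] := IH _ nGn.
  by move: dn; rewrite leq_eqVlt => /orP[/eqP E|//]; case: nG; rewrite -E.
by exists d => //; rewrite d1 ltnW.
Qed.

Hypothesis infp : mup setT = +oo%E.

Lemma sum_X_mdiff k : \sum_(i < size ('X^k : {poly R[i]})) 'X^k`_i * mdiff i = mdiff k.
Proof.
rewrite size_polyXn big_ord_recr /= coefXn eqxx mul1r big1 ?add0r // => i _.
by rewrite coefXn ltn_eqF ?mul0r //.
Qed.

(** * Root subspace when neither measure has an atom at [lam] *)

Section NoAtoms.
Hypotheses (mp0 : mass mup lam = 0) (mm0 : mass mum lam = 0).

Lemma coupled_r p bp bm : coupled p bp bm <-> \sum_(i < size p) p`_i * mdiff i = 0.
Proof. by rewrite /coupled mp0 mm0 cR0 !mulr0 subr0 add0r. Qed.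

Lemma step_ok_r c bp bm : step_ok c bp bm.
Proof. by rewrite /step_ok mp0 mm0 eqxx. Qed.

Lemma is_wvec_r v p bp bm : is_wvec v p bp bm -> is_wvec v p 0 0.
Proof.
by move=> [w1 w2]; split; [apply: aeeq_trans w1 _|apply: aeeq_trans w2 _];
  exact: wfun_massless.
Qed.

(** The criterion for the root subspace to have dimension at least [n]. *)
Definition good_r n := fins n /\ forall i, (i < n)%N -> mdiff i = 0.

Lemma good_r_le m n : (m <= n)%N -> good_r n -> good_r m.
Proof.
move=> mn [fn Fn]; split; first exact: fins_le fn.
by move=> i im; apply: Fn; exact: leq_trans mn.
Qed.

(** The earlier couplings have already annihilated all lower [mdiff i], so the new one reduces to
    leading coefficient times top difference. *)
Lemma root_vector_r n f : in_ker_pow mup Cp mum Cm lam n f ->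
  exists p, is_wvec f p 0 0 /\ good_r (size p).
Proof.
case/(root_vector_ind (P := fun p _ _ => forall i, (i < size p)%N -> mdiff i = 0)).
- by move=> i; rewrite size_poly0.
- move=> p bp bm c bp' bm' Pp _ fq /coupled_r cq.
  set q := p * 'X + c%:P in fq cq *.
  have low i : (i < (size q).-1)%N -> mdiff i = 0.
    move=> iq; apply: Pp; move: iq; rewrite /q size_MXaddC; case: ifP => //.
  have [q0|q0] := eqVneq q 0; first by move=> i; rewrite q0 size_poly0.
  have sq : size q = (size q).-1.+1 by rewrite prednK // lt0n size_poly_eq0.
  move=> i; rewrite sq ltnS leq_eqVlt => /orP[/eqP->|/low//].
  move/eqP: cq; rewrite (sum_mdiff_lead low) mulf_eq0 lead_coef_eq0 (negbTE q0).
  by move/eqP.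
- by move=> p [bp [bm [/is_wvec_r w fp Pp]]]; exists p.
Qed.

(** If [good_r] first fails at [d + 1], all root polynomials have size at most [d], and the
    monomials below [X^d] span. If [good_r n] holds, the monomials themselves form a chain. *)
Lemma dim_root_r n : dim_ge mup mum (rootspace mup Cp mum Cm lam) n <-> good_r n.
Proof.
split=> [|[fn Fn]].
  apply: contraPP => nG.
  have G0 : good_r 0 by split; [exact: fins0|].
  have [d /= dn [Gd nGd]] := first_failure G0 (leq0n n) nG.
  apply: (@dim_le _ _ _ _ d _ (fun j => wvec 'X^j 0 0) dn) => v [N /root_vector_r].
  move=> [p [[w1 w2] Gp]]; exists (fun j => p`_j).
  have pd : (size p <= d)%N.
    by rewrite leqNgt; apply/negP => dp; apply: nGd; exact: good_r_le Gp.
  have E t : wfun lam p 0 t = \sum_(j < d) p`_j * wfun lam 'X^j 0 t.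
    rewrite sum_wfun; congr (wfun _ _ _ t); last by rewrite big1 // => j _; rewrite mulr0.
    apply/polyP => i; rewrite coef_sum.
    under eq_bigr do rewrite coefZ coefXn.
    have [id|id] := ltnP i d; last first.
      rewrite nth_default ?(leq_trans pd) // big1 // => j _.
      by rewrite gtn_eqF ?mulr0 // (leq_trans _ id).
    rewrite (bigD1 (Ordinal id)) //= eqxx mulr1 big1 ?addr0 // => j ji.
    have /negbTE -> : i != j by apply: contra ji => /eqP ij; apply/eqP/val_inj.
    by rewrite mulr0.
  by split; [apply: aeeq_trans w1 _|apply: aeeq_trans w2 _]; apply: aeeq_eq => t; rewrite E.
(* The constant 1 is inserted at the first step only; every later step multiplies by [X]. *)
pose P k : {poly R[i]} := if k is k'.+1 then 'X^k' else 0.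
have K m : (m <= n)%N -> in_ker_pow mup Cp mum Cm lam m (wvec (P m) 0 0).
  apply: (@wvec_in_ker P (fun=> 0) (fun=> 0) (fun k => (k == 0%N)%:R)) => // k kn.
  split; last 2 first.
  - by rewrite size_polyXn; exact: fins_le fn.
  - by apply/coupled_r; rewrite sum_X_mdiff Fn.
  - case: k {kn} => [|k] /=; first by rewrite mul0r add0r expr0.
    by rewrite polyC0 addr0 exprSr.
  - exact: step_ok_r.
exists (fun i => wvec (P i.+1) 0 0); split=> [i|a [a1 _] i].
  by exists i.+1; exact: K.
(* One side suffices for independence, because [mup] has infinite total mass. *)
have P0 : \sum_(i < n) a i *: 'X^i = 0 :> {poly R[i]}.
  apply: (wfun_ae0 hp (lam := lam) (b := \sum_(i < n) a i * 0) infp).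
  by apply: aeeq_imp a1 => t /= E; rewrite -[RHS]E sum_wfun.
move/(congr1 (fun q : {poly R[i]} => q`_i)): P0.
rewrite coef0 coef_sum (bigD1 i) //= coefZ coefXn eqxx mulr1 big1 ?addr0 //.
by move=> j ji; rewrite coefZ coefXn (inj_eq val_inj) eq_sym (negbTE ji) mulr0.
Qed.

Lemma sigma_pA_r : fins 1 -> (sigma_pA mup Cp mum Cm lam <-> mdiff 0 = 0).
Proof.
move=> f1; split=> [/sigma_pA_eigen[f [fn0 [ch [Ech chS ch1]]]]|F0].
  have /eigen_form[c [bp [bm [w _ _ cc]]]] : in_ker_pow mup Cp mum Cm lam 1 f by exists ch.
  have [c0|c0] := eqVneq c 0.
    by case: fn0; apply/is_wvec0; move: w; rewrite c0 polyC0 => /is_wvec_r.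
  move/coupled_r: cc; rewrite size_polyC c0 big_ord1 coefC eqxx => /eqP.
  by rewrite mulf_eq0 (negbTE c0) => /eqP.
apply: (@wvec_sigma_pA 1 0 0); first by rewrite size_poly1.
- exact: step_ok_r.
- by apply/coupled_r; rewrite size_poly1 big_ord1 F0 mulr0.
- by case=> /(wfun_ae0 hp infp) /eqP; rewrite polyC1 oner_eq0.
Qed.

Lemma geom_mult_r : sigma_pA mup Cp mum Cm lam -> geom_mult mup Cp mum Cm lam (Some 1%N).
Proof.
move=> sp; split; first exact: eigenspace_dim_ge1.
apply: (@dim_le _ _ _ _ 1 _ (fun=> wvec 1 0 0)) => // v /eigen_form[c [bp [bm [/is_wvec_r[w1 w2] _ _ _]]]].
exists (fun=> c).
have E t : wfun lam c%:P 0 t = \sum_(j < 1) c * wfun lam 1 0 t.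
  by rewrite big_ord1 /wfun -polyC1 !hornerC; ring.
by split; [apply: aeeq_trans w1 _|apply: aeeq_trans w2 _]; apply: aeeq_eq => t; rewrite E.
Qed.

End NoAtoms.

(** * Root subspace when both measures have an atom at [lam] *)

Section Atoms.
Hypotheses (mp0 : mass mup lam != 0) (mm0 : mass mum lam != 0).

Let mp := cR (mass mup lam).
Let mm := cR (mass mum lam).

Let mm_neq0 : mm != 0.
Proof. by apply/eqP => -[] /eqP; rewrite (negbTE mm0). Qed.

Let mp_neq0 : mp != 0.
Proof. by apply/eqP => -[] /eqP; rewrite (negbTE mp0). Qed.

(* Predecessors are truncated, so [good_p 0] and [good_p 1] always hold. *)
Definition good_p n := [/\ (1 < n)%N -> mass mup lam = mass mum lam,
  fins n.-1 & forall i, (i < n.-2)%N -> mdiff i = 0].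

Lemma good_p_le m n : (m <= n)%N -> good_p n -> good_p m.
Proof.
move=> mn [En fn Fn]; split.
- by move=> m1; apply: En; exact: leq_trans mn.
- by apply: fins_le fn; rewrite -!subn1 leq_sub2r.
- by move=> i im; apply: Fn; apply: leq_trans im _; rewrite -!subn2 leq_sub2r.
Qed.

(** Equal values at equal masses cancel, which leaves the situation without atoms. *)
Lemma coupled_eq_masses p b : p != 0 -> mass mup lam = mass mum lam ->
  (forall i, (i < (size p).-1)%N -> mdiff i = 0) -> coupled p b b -> mdiff (size p).-1 = 0.
Proof.
move=> p0 E low; rewrite /coupled E subrr add0r (sum_mdiff_lead low) => /eqP.
by rewrite mulf_eq0 lead_coef_eq0 (negbTE p0) => /eqP.
Qed.

(** Values at the atoms can absorb any coupling, so a state imposes nothing by itself. The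
    constraint comes one step later, when [step_ok] forces both values to [- c]; hence the delay by
    one in [good_p]. *)
Lemma root_vector_p n f : in_ker_pow mup Cp mum Cm lam n f ->
  exists p bp bm, [/\ is_wvec f p bp bm, coupled p bp bm & good_p (size p).+1].
Proof.
case/(root_vector_ind (P := fun p bp bm => [/\ coupled p bp bm,
    p != 0 -> mass mup lam = mass mum lam &
    forall i, (i < (size p).-1)%N -> mdiff i = 0])).
- split; first by rewrite /coupled size_poly0 big_ord0 !mul0r subr0 addr0.
    by rewrite eqxx.
  by move=> i; rewrite size_poly0.
- move=> p bp bm c bp' bm' [cp Ep Fp] [/(_ mp0) bpc /(_ mm0) bmc] fq cq.
  subst bp bm; split=> // [q0|i].
    (* When the first nonzero constant enters, the preceding state is purely atomic with both values
       [- c], and its coupling says that the masses agree. *)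
    have [pz|/Ep//] := eqVneq p 0.
    have c0 : c != 0.
      by apply: contra q0 => /eqP ->; rewrite pz mul0r add0r polyC0.
    move: cp; rewrite /coupled pz size_poly0 big_ord0 addr0 -mulrBr => /eqP.
    by rewrite mulf_eq0 oppr_eq0 (negbTE c0) subr_eq0 => /eqP[].
  rewrite size_MXaddC; case: ifP => // _ /=.
  have [pz|pn0] := eqVneq p 0; first by rewrite pz size_poly0.
  have sp : size p = (size p).-1.+1 by rewrite prednK // lt0n size_poly_eq0.
  rewrite sp ltnS leq_eqVlt => /orP[/eqP->|/Fp//].
  exact: coupled_eq_masses pn0 (Ep pn0) Fp cp.
- move=> p [bp [bm [w fp [cp Ep Fp]]]]; exists p, bp, bm; split=> //; split=> //=.
  by move=> sp; apply: Ep; rewrite -size_poly_eq0 -lt0n.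
Qed.

(* In state [k.+2] the value at [lam] on the plus side is the one solving the
   coupling equation; it is [0] except possibly in the last state. *)
Definition pstate k : {poly R[i]} := if k is k'.+2 then 'X^k' else 0.
Definition pvalue k : R[i] := if k is k'.+2 then - mdiff k' / mp else - (k == 1%N)%:R.
Definition mvalue k : R[i] := if k is 1%N then - (mp / mm) else 0.

(** State 1 is the atomic eigenvector, with values balancing the masses. Inserting the constant 1
    next requires both values to be [-1], that is, equal masses; each later step requires value 0,
    that is, a vanishing [mdiff]. *)
Lemma pstates_in_ker n : good_p n -> forall m, (m <= n)%N ->
  in_ker_pow mup Cp mum Cm lam m (wvec (pstate m) (pvalue m) (mvalue m)).
Proof.
move=> [En fn Fn]; apply: (@wvec_in_ker _ _ _ (fun k => (k == 1%N)%:R)) => //.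
  by rewrite /pvalue oppr0.
move=> k kn; case: k kn => [_|[|k] kn].
- split; first by rewrite /= mul0r add0r polyC0.
  + by rewrite /step_ok /= !oppr0.
  + by rewrite size_poly0; exact: fins0.
  + by rewrite /coupled /= size_poly0 big_ord0 addr0 !mulNr mul1r divfK // subrr.
- split; first by rewrite /= mul0r add0r expr0.
  + by rewrite /step_ok /= -/mp /mp (En kn) divff.
  + by rewrite size_polyXn; apply: fins_le fn; rewrite -ltnS (leq_trans kn) // leqSpred.
  + by rewrite /coupled sum_X_mdiff /= mul0r subr0 divfK // addNr.
- have kn2 : (k < n.-2)%N by move: kn; case: (n) => [|[|]].
  split; first by rewrite /= polyC0 addr0 exprSr.
  + by rewrite /step_ok /= (Fn _ kn2) oppr0 mul0r.
  + by rewrite size_polyXn; apply: fins_le fn; move: kn; case: (n).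
  + by rewrite /coupled sum_X_mdiff /= mul0r subr0 divfK // addNr.
Qed.

(** As without atoms, but with one extra dimension from the atomic eigenvector: [d] monomials give
    the bound [d + 1]. *)
Lemma dim_root_p n : dim_ge mup mum (rootspace mup Cp mum Cm lam) n <-> good_p n.
Proof.
split=> [|Gn].
  apply: contraPP => nG.
  have G1 : good_p 1 by split => //; exact: fins0.
  have n1 : (1 <= n)%N.
    rewrite lt0n; apply/eqP => n0; apply: nG; rewrite n0; exact: good_p_le G1.
  have [[//|d] /= dn [Gd nGd]] := first_failure G1 n1 nG.
  (* The coupling determines [bm] from [p] and [bp], so the vectors [e] span. *)
  pose P (k : nat) : {poly R[i]} := if k is k'.+1 then 'X^k' else 0.
  pose B (k : nat) := if k is k'.+1 then mdiff k' / mm else mp / mm.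
  pose e (k : nat) := wvec (P k) (k == 0%N)%:R (B k).
  apply: (@dim_le _ _ _ _ d.+1 _ (fun j => e j)) => // v [N /root_vector_p].
  move=> [p [bp [bm [[w1 w2] cp Gp]]]].
  pose x (j : nat) := if j is j'.+1 then p`_j' else bp.
  exists (fun j => x j).
  have pd : (size p <= d)%N.
    by rewrite leqNgt; apply/negP => dp; apply: nGd; exact: good_p_le Gp.
  have Ep : p = \sum_(i < d.+1) x i *: P i.
    rewrite big_ord_recl scaler0 add0r; apply/polyP => i; rewrite coef_sum.
    under eq_bigr do rewrite coefZ coefXn.
    have [id|id] := ltnP i d; last first.
      rewrite nth_default ?(leq_trans pd) // big1 // => j _.
      by rewrite gtn_eqF ?mulr0 // (leq_trans _ id).
    rewrite (bigD1 (Ordinal id)) //= eqxx mulr1 big1 ?addr0 // => j ji.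
    have /negbTE -> : i != j by apply: contra ji => /eqP ij; apply/eqP/val_inj.
    by rewrite mulr0.
  have Ebm : bm = bp * (mp / mm) + \sum_(i < d) p`_i * (mdiff i / mm).
    have S : \sum_(i < d) p`_i * mdiff i = \sum_(i < size p) p`_i * mdiff i.
      rewrite (big_ord_widen d (fun i => p`_i * mdiff i) pd) [RHS]big_mkcond.
      by apply: eq_bigr => i _; case: ltnP => // H; rewrite nth_default ?mul0r.
    have -> : \sum_(i < d) p`_i * (mdiff i / mm) = (\sum_(i < d) p`_i * mdiff i) / mm.
      by rewrite mulr_suml; apply: eq_bigr => i _; rewrite mulrA.
    move: cp; rewrite /coupled -/mp -/mm S => /eqP.
    rewrite addrAC subr_eq0 => /eqP E; apply: (mulIf mm_neq0).
    by rewrite -E mulrDl -mulrA !divfK.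
  have E1 t : wfun lam p bp t = \sum_(j < d.+1) x j * (e j).1 t.
    rewrite sum_wfun -Ep; congr (wfun _ _ _ t).
    by rewrite big_ord_recl mulr1 big1 ?addr0 // => i _; rewrite mulr0.
  have E2 t : wfun lam p bm t = \sum_(j < d.+1) x j * (e j).2 t.
    by rewrite sum_wfun -Ep; congr (wfun _ _ _ t); rewrite big_ord_recl.
  by split; [apply: aeeq_trans w1 _|apply: aeeq_trans w2 _]; apply: aeeq_eq => t; rewrite ?E1 ?E2.
exists (fun i => wvec (pstate i.+1) (pvalue i.+1) (mvalue i.+1)); split=> [i|a [a1 _] i].
  by exists i.+1; exact: (pstates_in_ker Gn).
have a1' : aeeq mup (wfun lam (\sum_(i < n) a i *: pstate i.+1)
    (\sum_(i < n) a i * pvalue i.+1)) (fun=> 0).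
  by apply: aeeq_imp a1 => t /= E; rewrite -[RHS]E sum_wfun.
have P0 := wfun_ae0 hp infp a1'.
(* The polynomial part yields every coefficient except that of the atomic vector; the latter is
   recovered at the end by evaluation at the atom. *)
have ak (j : 'I_n) : (0 < j)%N -> a j = 0.
  case: j => [[//|k] kn] _.
  move/(congr1 (fun q : {poly R[i]} => q`_k)): P0.
  rewrite coef0 coef_sum (bigD1 (Ordinal kn)) //= coefZ coefXn eqxx mulr1 big1 ?addr0 //.
  move=> [[|j] jn] ji; rewrite coefZ ?coef0 ?mulr0 //= coefXn.
  suff /negbTE -> : k != j by rewrite mulr0.
  by apply: contra ji => /eqP ij; apply/eqP/val_inj; rewrite /= ij.
have [i0|] := posnP i; last exact: ak.
move: a1'; rewrite P0 => a1'.
have := @at_pt_ae0 _ _ hp lam _ mp0 (aeeq_trans _ a1').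
move=> /(_ (\sum_(i < n) a i * pvalue i.+1)).
rewrite (bigD1 i) //= big1 ?addr0.
  rewrite i0 /= mulrN1 => H; apply/eqP; rewrite -oppr_eq0; apply/eqP; apply: H.
  by apply: aeeq_eq => t; rewrite /wfun horner0 mulr0 add0r.
move=> j ji; rewrite ak ?mul0r // lt0n; apply: contra ji => /eqP j0.
by apply/eqP/val_inj; rewrite /= j0 i0.
Qed.

(** The indicator on each side, weighted by [1] and [mp / mm], balances the coupling with
    [c = 0]. *)
Lemma sigma_pA_p : sigma_pA mup Cp mum Cm lam.
Proof.
apply: (@wvec_sigma_pA 0 1 (mp / mm)); rewrite ?polyC0 ?size_poly0.
- exact: fins0.
- by rewrite /step_ok oppr0.
- by rewrite /coupled size_poly0 big_ord0 addr0 mul1r divfK // subrr.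
- case=> H _; have := @at_pt_ae0 _ _ hp lam 1 mp0.
  have E : aeeq mup (fun t => 1 * at_pt lam t) (fun=> 0).
    by apply: aeeq_imp H => t /=; rewrite /wfun horner0 mulr0 add0r.
  by move=> /(_ E)/eqP; rewrite oner_eq0.
Qed.

Lemma geom_mult_p : geom_mult mup Cp mum Cm lam (Some 1%N).
Proof.
split; first exact: eigenspace_dim_ge1 sigma_pA_p.
apply: (@dim_le _ _ _ _ 1 _ (fun=> wvec 0 1 (mp / mm))) => // v.
move=> /eigen_form[c [bp [bm [[w1 w2] [/(_ mp0) c0 _] _ cc]]]].
have {}c0 : c = 0 by apply/eqP; rewrite -oppr_eq0 -c0.
subst c; rewrite polyC0 in w1 w2 cc; exists (fun=> bp).
have Ebm : bm = bp * (mp / mm).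
  move: cc; rewrite /coupled size_poly0 big_ord0 addr0 => /eqP; rewrite subr_eq0 => /eqP E.
  by apply: (mulIf mm_neq0); rewrite -[LHS]E -mulrA divfK.
split; [apply: aeeq_trans w1 _|apply: aeeq_trans w2 _]; apply: aeeq_eq => t;
  by rewrite big_ord1 /= /wfun !horner0 ?Ebm !mulr0 !add0r ?mul1r ?mulrA.
Qed.

End Atoms.

End RootVectors.

(** * Derivatives and vertical limits of the moments *)

Section Shift.
Variable R : realType.
Implicit Types (x y h z lam : R[i]) (t eps : R).

(* The hypothesis is the resolvent identity for [x = (t - z)^-1] and
   [y = (t - (z + h))^-1]. *)
Lemma normc_shift_pow n : exists2 K : R, 0 <= K & forall x y h,
  y = x + h * x * y -> normc y <= 2 * normc x ->
  normc (y ^+ n - x ^+ n) <= K * normc h * normc x ^+ n.+1.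
Proof.
elim: n => [|n [K K0 IH]].
  by exists 0 => // x y h _ _; rewrite subrr normc0 mul0r mul0r.
exists (2 * K + 2) => [|x y h yx y2]; first by rewrite addr_ge0 ?mulr_ge0.
have -> : y ^+ n.+1 - x ^+ n.+1 = y * (y ^+ n - x ^+ n) + h * x ^+ n.+1 * y.
  rewrite !exprS; have D : y - x = h * x * y by rewrite {1}yx addrAC subrr add0r.
  transitivity (y * (y ^+ n - x ^+ n) + (y - x) * x ^+ n); first by ring.
  by rewrite D; ring.
apply: le_trans (le_normcD _ _) _; rewrite !normcM normcX.
have key (d A H Y a : R) : 0 <= d -> 0 <= A -> 0 <= H -> 0 <= Y ->
    d <= K * H * A -> Y <= 2 * a -> Y * d + H * A * Y <= (2 * K + 2) * H * (a * A).
  move=> d0 A0 H0 Y0 dA ya.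
  have P1 : Y * d <= 2 * a * (K * H * A) by apply: ler_pM.
  have P2 : H * A * Y <= H * A * (2 * a) by apply: ler_wpM2l => //; exact: mulr_ge0.
  by apply: le_trans (lerD P1 P2) _; rewrite le_eqVlt; apply/orP; left; apply/eqP; ring.
rewrite [normc x ^+ n.+2]exprS.
by apply: key; rewrite ?exprn_ge0 ?normc_ge0 //; exact: IH.
Qed.

(** Second-order Taylor remainder: that of [n + 1] is [y] times that of [n] plus a term quadratic in
    [h], which gives the induction. *)
Lemma normc_shift_pow2 n : exists2 K : R, 0 <= K & forall x y h,
  y = x + h * x * y -> normc y <= 2 * normc x ->
  normc (y ^+ n - x ^+ n - n%:R * h * x ^+ n.+1) <= K * normc h ^+ 2 * normc x ^+ n.+2.
Proof.
elim: n => [|n [K K0 IH]].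
  by exists 0 => // x y h _ _; rewrite !mul0r subrr subr0 normc0.
exists (2 * K + n.+1%:R * 2) => [|x y h yx y2].
  by rewrite addr_ge0 ?mulr_ge0 ?ler0n.
have -> : y ^+ n.+1 - x ^+ n.+1 - n.+1%:R * h * x ^+ n.+2 =
    y * (y ^+ n - x ^+ n - n%:R * h * x ^+ n.+1) + n.+1%:R * (h ^+ 2 * x ^+ n.+2 * y).
  rewrite -natr1 !exprS; set X := x ^+ n; set Y := y ^+ n.
  have D : y - x - h * x * y = 0 by rewrite {1}yx addrAC addrK subrr.
  apply/eqP; rewrite -subr_eq0; apply/eqP.
  (* The difference of the two sides is a multiple of the resolvent relation [y - x - h x y = 0]. *)
  transitivity (X * (1 + (n%:R + 1) * h * x) * (y - x - h * x * y)); first by ring.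
  by rewrite D mulr0.
have nN : normc (n.+1%:R : R[i]) = n.+1%:R.
  by rewrite -[X in normc X](rmorph_nat (real_complex R)) normc_cR ger0_norm ?ler0n.
apply: le_trans (le_normcD _ _) _.
rewrite (normcM y) (normcM n.+1%:R) nN (normcM _ y) (normcM (h ^+ 2)) !normcX.
have key (N d A H Y a : R) : 0 <= N -> 0 <= d -> 0 <= A -> 0 <= H -> 0 <= Y ->
    d <= K * H ^+ 2 * A -> Y <= 2 * a ->
    Y * d + N * (H ^+ 2 * A * Y) <= (2 * K + N * 2) * H ^+ 2 * (a * A).
  move=> N0 d0 A0 H0 Y0 dA ya.
  have P1 : Y * d <= 2 * a * (K * H ^+ 2 * A) by apply: ler_pM.
  have P2 : N * (H ^+ 2 * A * Y) <= N * (H ^+ 2 * A * (2 * a)).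
    by do 2! [apply: ler_wpM2l => //]; rewrite mulr_ge0 ?sqr_ge0.
  by apply: le_trans (lerD P1 P2) _; rewrite le_eqVlt; apply/orP; left; apply/eqP; ring.
rewrite [normc x ^+ n.+3]exprS.
by apply: key; rewrite ?exprn_ge0 ?normc_ge0 ?ler0n //; exact: IH.
Qed.

Lemma res_shift z h t : cR t != z -> cR t != z + h ->
  res (z + h) t = res z t + h * res z t * res (z + h) t.
Proof.
rewrite /res -![cR t == _]subr_eq0 => tz tzh.
have E : cR t - z = cR t - (z + h) + h by ring.
move: E tz tzh; move: (cR t - z) (cR t - (z + h)) => b c -> b0 c0.
by field; rewrite b0 c0.
Qed.

Lemma res_shift_le z h t : cR t != z -> 2 * normc h <= normc (cR t - z) ->
  cR t != z + h /\ normc (res (z + h) t) <= 2 * normc (res z t).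
Proof.
rewrite -subr_eq0 -normc_eq0 => tz hz.
have n0 : 0 < normc (cR t - z) by rewrite lt_neqAle eq_sym tz normc_ge0.
have B : normc (cR t - z) <= 2 * normc (cR t - (z + h)).
  have : normc (cR t - z) <= normc (cR t - (z + h)) + normc h.
    by apply: le_trans (le_normcD _ _); rewrite opprD addrA subrK.
  move: hz; lra.
have m0 : 0 < normc (cR t - (z + h)) by move: n0 B; lra.
split; first by rewrite -subr_eq0 -normc_eq0 gt_eqF.
rewrite /res !normcV ler_pdivlMr // mulrC ler_pdivrMr //.
Qed.

Lemma cIm_le_normc_sub z t : `|cIm z| <= normc (cR t - z).
Proof.
apply: le_trans (le_cIm_normc _); case: z => a b /=.
by rewrite add0r normrN.
Qed.

Lemma nonreal_neq z t : cIm z != 0 -> cR t != z.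
Proof. by apply: contra => /eqP <-. Qed.

(** For real [lam] a vertical move only increases the distance to real points; for nonreal [lam]
    moves below half of its imaginary part fall under [res_shift_le]. *)
Lemma vertical_res_le lam : exists2 d : R, 0 < d & forall eps, eps != 0 -> `|eps| < d ->
  cIm (lam + ci R * cR eps) != 0 /\ forall t, cR t != lam ->
  normc (res (lam + ci R * cR eps) t) <= 2 * normc (res lam t).
Proof.
have Eim eps : cIm (lam + ci R * cR eps) = cIm lam + eps.
  by rewrite cImD cImM /= mul0r add0r mul1r.
have [l0|l0] := eqVneq (cIm lam) 0.
  exists 1 => // eps e0 _; rewrite Eim l0 add0r; split=> // t tl.
  have n0 : 0 < normc (cR t - lam) by rewrite lt_neqAle normc_ge0 eq_sym normc_eq0 subr_eq0 tl.
  have L : normc (cR t - lam) <= normc (cR t - (lam + ci R * cR eps)).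
    case: lam l0 {Eim tl n0} => a b /= ->; rewrite /cR /ci; simpc => /=.
    by rewrite ler_wsqrtr // expr0n addr0 lerDl sqr_ge0.
  rewrite /res !normcV; apply: (@le_trans _ _ (normc (cR t - lam))^-1).
    by rewrite lef_pV2 ?posrE // (lt_le_trans n0).
  by rewrite ler_peMl ?invr_ge0 ?ltW // ltr1n.
exists (`|cIm lam| / 2) => [|eps e0 el]; first by rewrite divr_gt0 ?normr_gt0.
split.
  rewrite Eim; apply/eqP => /eqP; rewrite addr_eq0 => /eqP E.
  move: el; rewrite E normrN; have : 0 < `|eps| by rewrite normr_gt0.
  lra.
move=> t tl; apply: (res_shift_le tl _).2; rewrite normc_ci_mul.
apply: le_trans (cIm_le_normc_sub _ _); move: el; lra.
Qed.

End Shift.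

Section Derivatives.
Variable R : realType.
Implicit Types (x y h z lam : R[i]) (t eps : R).

Section OneMeasure.
Variables (mu : {measure set R -> \bar R}) (C : R).
Hypothesis hmu : rint mu (fun t => (1 + t ^+ 2)^-1).

Lemma MfunE z : Mfun mu C z = mom mu C z 0.
Proof.
rewrite /Mfun /mom mul1r; congr (_ + _); congr cint; apply/funext => t.
by rewrite /rker expr1 mul1r /ht [1 + _]addrC.
Qed.

(** All but two resolvent factors are bounded by the inverse distance to the real line; the
    remaining square is comparable with the weight. *)
Lemma fin_pow_nonreal z j : cIm z != 0 -> (0 < j)%N -> fin_pow mu z j.
Proof.
case: j => // j z0 _.
have y0 : 0 < `|cIm z| by rewrite normr_gt0.
(* With [a] the real part of [z], [t^2 <= 2 (t - a)^2 + 2 a^2] gives [1 + t^2 <= K |t - z|^2]. *)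
pose K := 2 + (1 + 2 * cRe z ^+ 2) / cIm z ^+ 2.
apply: rint_le (rintZ (`|cIm z| ^- (2 * j) * K) hmu) _ => [|t]; first exact: measurable_res_pow.
rewrite ger0_norm ?exprn_ge0 ?normc_ge0 // mulnS addnC exprD -mulrA.
have N0 : 0 < normc (cR t - z) by apply: lt_le_trans (cIm_le_normc_sub _ _).
apply: ler_pM; rewrite ?exprn_ge0 ?normc_ge0 //.
  rewrite -exprVn; apply: lerXn2r; rewrite ?nnegrE ?normc_ge0 ?invr_ge0 ?normr_ge0 //.
  by rewrite /res normcV lef_pV2 ?posrE //; exact: cIm_le_normc_sub.
rewrite /res normcV exprVn -cabs2E ler_pdivlMr ?one_sqr_gt0 // mulrC ler_pdivrMr; last first.
  by rewrite cabs2E exprn_gt0.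
rewrite /cabs2 cReD cImD cReN cImN /= add0r sqrrN /K.
have b0 : 0 < cIm z ^+ 2 by rewrite exprn_even_gt0.
move: (cRe z) (cIm z ^+ 2) b0 => a b b0.
have E : (1 + 2 * a ^+ 2) / b * b = 1 + 2 * a ^+ 2 by rewrite divfK // gt_eqF.
have q0 : 0 <= (1 + 2 * a ^+ 2) / b.
  by rewrite divr_ge0 ?(ltW b0) // addr_ge0 // mulr_ge0 // sqr_ge0.
move: ((1 + 2 * a ^+ 2) / b) E q0 => q E q0.
have := sqr_ge0 (t - 2 * a); have : 0 <= q * (t - a) ^+ 2 by rewrite mulr_ge0 ?sqr_ge0.
nra.
Qed.

Lemma nonreal_shift z h : cIm z != 0 -> 2 * normc h <= `|cIm z| -> cIm (z + h) != 0.
Proof.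
rewrite -normr_gt0 => z0 hz; rewrite cImD; apply/eqP => /eqP; rewrite addr_eq0 => /eqP E.
move: hz z0; rewrite E normrN; have := le_cIm_normc h; lra.
Qed.

Lemma cintegrable_rker_nonreal z i : cIm z != 0 -> cintegrable mu (rker i z).
Proof.
by move=> z0; apply: cintegrable_rker => // j /andP[j0 _]; exact: fin_pow_nonreal.
Qed.

(** The pointwise remainder of [normc_shift_pow2] is integrated; the constant [C] and the
    regularising term cancel in the difference. *)
Lemma mom_deriv_bound z i : cIm z != 0 -> exists2 B : R, 0 <= B & forall h,
  2 * normc h <= `|cIm z| ->
  normc (mom mu C (z + h) i - mom mu C z i - h * (i.+1%:R * mom mu C z i.+1)) <=
    B * normc h ^+ 2.
Proof.
move=> z0; have [K K0 HK] := normc_shift_pow2 R i.+1.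
have ig : rint mu (fun t => normc (res z t) ^+ i.+3).
  apply: (@fin_pow_between _ _ z i.+3); rewrite ?leq_pmull //; exact: fin_pow_nonreal.
have g0 : 0 <= \int[mu]_t (normc (res z t) ^+ i.+3).
  by apply: Rintegral_ge0 => t _; rewrite exprn_ge0 ?normc_ge0.
exists (2 * (K * \int[mu]_t (normc (res z t) ^+ i.+3))) => [|h hz].
  by rewrite !mulr_ge0.
have zh0 := nonreal_shift z0 hz.
have I1 := cintegrable_rker_nonreal i zh0; have I2 := cintegrable_rker_nonreal i z0.
have I3 := cintegrable_rker_nonreal i.+1 z0.
have -> : mom mu C (z + h) i - mom mu C z i - h * (i.+1%:R * mom mu C z i.+1) =
    cint mu setT (fun t => rker i (z + h) t - rker i z t - (h * i.+1%:R) * rker i.+1 z t).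
  rewrite (cintB (cintegrableB I1 I2) (cintegrableZ _ I3)) (cintB I1 I2) (cintZ _ I3).
  rewrite /mom mul0r add0r; move: (i.+1%:R) (cint mu _ (rker i.+1 z)) => N M.
  move: (cint mu _ (rker i z)) (cint mu _ (rker i (z + h))) (_ * cR C) => a b c.
  by ring.
have mE : cmeas (fun t => rker i (z + h) t - rker i z t - (h * i.+1%:R) * rker i.+1 z t).
  apply: cmeasB; last by apply: cmeasM (cmeas_cst _) _; exact: cmeas_rker.
  by apply: cmeasB; exact: cmeas_rker.
apply: le_trans (normc_cint_le mE (rintZ (K * normc h ^+ 2) ig) _) _ => [t|]; last first.
  by rewrite RintegralZl // le_eqVlt; apply/orP; left; apply/eqP; ring.
have tz := nonreal_neq t z0; have hz' := le_trans hz (cIm_le_normc_sub z t).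
have [tzh yx] := res_shift_le tz hz'.
apply: le_trans (HK _ _ _ (res_shift tz tzh) yx).
rewrite /rker mul0r subr0 le_eqVlt; apply/orP; left; apply/eqP; congr normc; ring.
Qed.

(* An atom at [lam] contributes the singular term that is subtracted here; it
   cancels between two measures with equal atoms. *)
Lemma mom_vertical lam i : (forall j, (0 < j <= i.+1)%N -> fin_pow mu lam j) ->
  exists B d : R, [/\ 0 <= B, 0 < d & forall eps, eps != 0 -> `|eps| < d ->
    normc (mom mu C (lam + ci R * cR eps) i - mom mu C lam i
      - (- (ci R * cR eps))^-1 ^+ i.+1 * cR (mass mu lam)) <= B * `|eps|].
Proof.
move=> fi; have [K K0 HK] := normc_shift_pow R i.+1.
have [d d0 Hd] := vertical_res_le lam.
have ig : rint mu (fun t => normc (res lam t) ^+ i.+2).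
  apply: (@fin_pow_between _ _ lam i.+1); [exact: fi|by apply: fi; rewrite leqnn|].
  by rewrite mul2n doubleS -addnn !ltnS leq_addl.
have g0 : 0 <= \int[mu]_t (normc (res lam t) ^+ i.+2).
  by apply: Rintegral_ge0 => t _; rewrite exprn_ge0 ?normc_ge0.
exists (2 * (K * \int[mu]_t (normc (res lam t) ^+ i.+2))), d; split=> // [|eps e0 ed].
  by rewrite !mulr_ge0.
have [z0 Hz] := Hd _ e0 ed; set h := ci R * cR eps in z0 Hz *.
have nh : normc h = `|eps| by rewrite normc_ci_mul.
have I1 := cintegrable_rker_nonreal i z0; have I2 := cintegrable_rker hmu fi.
have I3 := cintegrable_at_pt hmu lam.
have -> : mom mu C (lam + h) i - mom mu C lam i - (- h)^-1 ^+ i.+1 * cR (mass mu lam) =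
    cint mu setT (fun t => rker i (lam + h) t - rker i lam t - (- h)^-1 ^+ i.+1 * at_pt lam t).
  rewrite (cintB (cintegrableB I1 I2) (cintegrableZ _ I3)) (cintB I1 I2) (cintZ _ I3).
  rewrite cint_at_pt.
  rewrite /mom; move: (mass mu lam) ((- h)^-1 ^+ i.+1) => N M.
  move: (cint mu _ (rker i lam)) (cint mu _ (rker i (lam + h))) (_ * cR C) => a b c.
  by ring.
have mE : cmeas (fun t => rker i (lam + h) t - rker i lam t - (- h)^-1 ^+ i.+1 * at_pt lam t).
  apply: cmeasB; last by apply: cmeasM (cmeas_cst _) _; exact: cmeas_at_pt.
  by apply: cmeasB; exact: cmeas_rker.
apply: le_trans (normc_cint_le mE (rintZ (K * `|eps|) ig) _) _ => [t|]; last first.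
  by rewrite RintegralZl // le_eqVlt; apply/orP; left; apply/eqP; ring.
rewrite /rker (_ : forall a b c e : R[i], a - c - (b - c) - e = a - b - e); last first.
  by move=> *; ring.
(* At [t = lam] the old resolvent is 0 and the shifted one is [(- h)^-1], so the corrected integrand
   vanishes exactly. *)
have [tl|tl] := eqVneq (cR t) lam.
  rewrite /at_pt /res tl eqxx subrr invr0 opprD addrA subrr sub0r expr0n subr0 mulr1 subrr.
  by rewrite normc0 mulr_ge0 ?exprn_ge0 ?lexx ?normc_ge0 // mulr_ge0 ?normr_ge0.
have tzh := nonreal_neq t z0; rewrite /at_pt (negbTE tl) mulr0 subr0 -nh.
exact: HK (res_shift tl tzh) (Hz t tl).
Qed.

End OneMeasure.

Lemma has_cderiv_quad (F : R[i] -> R[i]) z l (B r : R) : 0 < r -> 0 <= B ->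
  (forall h, normc h < r -> normc (F (z + h) - F z - h * l) <= B * normc h ^+ 2) ->
  has_cderiv F z l.
Proof.
move=> r0 B0 HB e e0; have B1 : 0 < B + 1 by rewrite ltr_wpDl.
exists (Num.min r (e / (B + 1))); split; first by rewrite lt_min r0 divr_gt0.
move=> h h0; rewrite ltcR_normc lt_min => /andP[hr]; rewrite ltr_pdivlMr // => he.
have -> : (F (z + h) - F z) / h - l = (F (z + h) - F z - h * l) / h.
  by rewrite [RHS]mulrBl [h * l]mulrC mulfK.
have n0 : 0 < normc h by rewrite lt_neqAle normc_ge0 eq_sym normc_eq0 h0.
rewrite ltcR_normc normcM normcV ltr_pdivrMr //; apply: le_lt_trans (HB h hr) _.
rewrite expr2 mulrA ltr_pM2r //; apply: le_lt_trans he; rewrite mulrC ler_pM2l //.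
by rewrite lerDl.
Qed.

Lemma has_cderiv_unique (F : R[i] -> R[i]) z l l' :
  has_cderiv F z l -> has_cderiv F z l' -> l = l'.
Proof.
move=> H H'; apply/eqP; rewrite -subr_eq0 -normc_eq0; apply/eqP.
apply/eqP; rewrite eq_le normc_ge0 andbT; apply/ler_addgt0Pr => e e0; rewrite add0r.
have e2 : 0 < e / 2 by rewrite divr_gt0.
have [d [d0 Hd]] := H _ e2; have [d' [d'0 Hd']] := H' _ e2.
pose h : R[i] := cR (Num.min d d' / 2).
have m0 : 0 < Num.min d d' by rewrite lt_min d0.
have h0 : h != 0 by rewrite -normc_eq0 normc_cR normr_eq0 gt_eqF // divr_gt0.
have nh : normc h < Num.min d d'.
  by rewrite normc_cR ger0_norm ?divr_ge0 ?(ltW m0) // gtr_pMr // invf_lt1 // ltr1n.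
have := Hd h h0; have := Hd' h h0; rewrite !ltcR_normc.
move: nh; rewrite lt_min => /andP[-> ->] /(_ isT) A /(_ isT) B.
set Q := _ / h in A B.
have -> : l - l' = (Q - l') - (Q - l) by ring.
apply: le_trans (le_normcD _ _) _; rewrite normcN; move: A B; lra.
Qed.

(** Differentiation is local; this matters because the formula for iterated derivatives holds only
    off the real line. *)
Lemma has_cderiv_near (F G : R[i] -> R[i]) z l (r : R) : 0 < r ->
  (forall h, normc h < r -> F (z + h) = G (z + h)) -> has_cderiv F z l -> has_cderiv G z l.
Proof.
move=> r0 E H e e0; have [d [d0 Hd]] := H e e0.
exists (Num.min d r); split; first by rewrite lt_min d0.
move=> h h0; rewrite ltcR_normc lt_min => /andP[hd hr].
have -> : G z = F z by rewrite -[z]addr0 E ?normc0.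
by rewrite -E //; apply: Hd => //; rewrite ltcR_normc.
Qed.

(** [cderiv] chooses some derivative; by uniqueness it is this one. *)
Lemma cderivE (F : R[i] -> R[i]) z l : has_cderiv F z l -> cderiv F z = l.
Proof.
move=> H; apply: (has_cderiv_unique (F := F) (z := z)) => //.
rewrite /cderiv; exact: (@xgetI _ 0 (fun l => has_cderiv F z l) l H).
Qed.

Section TwoMeasures.
Variables (mup mum : {measure set R -> \bar R}) (Cp Cm : R).
Hypothesis hp : rint mup (fun t => (1 + t ^+ 2)^-1).
Hypothesis hm : rint mum (fun t => (1 + t ^+ 2)^-1).

Let Phi := fun z : R[i] => Mfun mup Cp z - Mfun mum Cm z.

(** The induction hypothesis is applied on the disc of radius half the imaginary part, which avoids
    the real line; each derivative contributes a factor [n + 1]. *)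
Lemma cderivn_Phi n z : cIm z != 0 ->
  cderivn n Phi z = n`!%:R * mdiff mup mum Cp Cm z n.
Proof.
elim: n z => [|n IH] z z0.
  by rewrite /= /Phi !MfunE fact0 mul1r.
apply: cderivE.
have [B1 B10 H1] := mom_deriv_bound Cp hp n z0.
have [B2 B20 H2] := mom_deriv_bound Cm hm n z0.
have z1 : 0 < `|cIm z| / 2 by rewrite divr_gt0 ?normr_gt0.
have small h : normc h < `|cIm z| / 2 -> 2 * normc h <= `|cIm z| by lra.
apply: (has_cderiv_near (F := fun z => n`!%:R * mdiff mup mum Cp Cm z n) z1).
  by move=> h hz; symmetry; apply: IH; apply: nonreal_shift z0 _; exact: small.
apply: (has_cderiv_quad (B := normc n`!%:R * (B1 + B2)) z1).
  by rewrite mulr_ge0 ?normc_ge0 ?addr_ge0.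
move=> h /small hz.
have -> : n`!%:R * mdiff mup mum Cp Cm (z + h) n - n`!%:R * mdiff mup mum Cp Cm z n -
    h * (n.+1`!%:R * mdiff mup mum Cp Cm z n.+1) = n`!%:R *
    ((mom mup Cp (z + h) n - mom mup Cp z n - h * (n.+1%:R * mom mup Cp z n.+1)) -
     (mom mum Cm (z + h) n - mom mum Cm z n - h * (n.+1%:R * mom mum Cm z n.+1))).
  rewrite /mdiff factS natrM.
  move: (n`!%:R) (n.+1%:R) (mom mup _ _ _) (mom mup _ _ _) (mom mup _ _ _) => a b m1 m2 m3.
  by move: (mom mum _ _ _) (mom mum _ _ _) (mom mum _ _ _) => m4 m5 m6; ring.
rewrite normcM -mulrA ler_wpM2l ?normc_ge0 // mulrDl.
apply: le_trans (le_normcD _ _) _; rewrite normcN; apply: lerD; [exact: H1|exact: H2].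
Qed.

(** Equal masses cancel the singular terms of [mom_vertical], so along the vertical line the
    derivative is [n! F_n] up to [O(eps)]. *)
Lemma lim0_vertical_Phi lam n : fins mup mum lam n.+1 -> mass mup lam = mass mum lam ->
  lim0_vertical (cderivn n Phi) lam <-> mdiff mup mum Cp Cm lam n = 0.
Proof.
move=> fn Em; have [d0 d00 Hd] := vertical_res_le lam.
have [B1 [d1 [B10 d10 H1]]] := mom_vertical Cp hp (fun j Hj => (fn j Hj).1).
have [B2 [d2 [B20 d20 H2]]] := mom_vertical Cm hm (fun j Hj => (fn j Hj).2).
pose N : R := normc (n`!%:R : R[i]).
have N0 : 0 <= N by exact: normc_ge0.
have fact_neq0 : (n`!%:R : R[i]) != 0 by rewrite pnatr_eq0 -lt0n fact_gt0.
have T (a b : R[i]) : normc (a - b) <= normc a + normc b.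
  by rewrite -(normcN b) le_normcD.
have close eps : eps != 0 -> `|eps| < d0 -> `|eps| < d1 -> `|eps| < d2 ->
    normc (cderivn n Phi (lam + ci R * cR eps) - n`!%:R * mdiff mup mum Cp Cm lam n)
    <= N * (B1 + B2) * `|eps|.
  move=> e0 ed0 ed1 ed2; have [z0 _] := Hd _ e0 ed0.
  rewrite cderivn_Phi // -mulrBr normcM -mulrA ler_wpM2l // mulrDl.
  apply: le_trans (lerD (H1 _ e0 ed1) (H2 _ e0 ed2)).
  apply: le_trans (T _ _); rewrite le_eqVlt; apply/orP; left; apply/eqP; congr normc.
  rewrite /mdiff Em; move: (_ ^+ n.+1 * _) (mom mup _ _ _) (mom mup _ _ _) => a m1 m2.
  by move: (mom mum _ _ _) (mom mum _ _ _) => m3 m4; ring.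
have B3 : 0 < N * (B1 + B2) + 1 by rewrite ltr_wpDl // mulr_ge0 // addr_ge0.
have lip (e eps : R) : 0 < e -> `|eps| < e / (N * (B1 + B2) + 1) ->
    N * (B1 + B2) * `|eps| < e.
  move=> e0; rewrite ltr_pdivlMr // mulrC; apply: le_lt_trans.
  by rewrite ler_wpM2r ?normr_ge0 // lerDl.
split=> [L|M0 e e0].
  suff : n`!%:R * mdiff mup mum Cp Cm lam n = 0.
    by move/eqP; rewrite mulf_eq0 (negbTE fact_neq0) => /eqP.
  apply/eqP; rewrite -normc_eq0 eq_le normc_ge0 andbT; apply/ler_addgt0Pr => e e0.
  rewrite add0r; have e2 : 0 < e / 2 by rewrite divr_gt0.
  have [d [dpos HL]] := L _ e2.
  pose D := Num.min d (Num.min d0 (Num.min d1 (Num.min d2 (e / 2 / (N * (B1 + B2) + 1))))).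
  have D0 : 0 < D by rewrite !lt_min dpos d00 d10 d20 divr_gt0.
  (* Both estimates are compared at the single point [eps = D / 2], for each tolerance [e]. *)
  have eps0 : D / 2 != 0 by rewrite gt_eqF ?divr_gt0.
  have : `|D / 2| < D.
    by rewrite ger0_norm ?divr_ge0 ?(ltW D0) // gtr_pMr // invf_lt1 // ltr1n.
  rewrite {2}/D !lt_min => /and5P[l1 l2 l3 l4 l5].
  have := HL _ eps0 l1; rewrite ltcR_normc => A.
  have := close _ eps0 l2 l3 l4; have := lip _ _ e2 l5.
  set X := cderivn _ _ _ in A *; set Y := n`!%:R * _.
  have : normc Y <= normc X + normc (X - Y).
    by have := T X (X - Y); rewrite (_ : X - (X - Y) = Y) //; ring.
  move: A; lra.
exists (Num.min d0 (Num.min d1 (Num.min d2 (e / (N * (B1 + B2) + 1))))).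
split; first by rewrite !lt_min d00 d10 d20 divr_gt0.
move=> eps eps0; rewrite !lt_min => /and4P[l2 l3 l4 l5]; rewrite ltcR_normc.
have := close _ eps0 l2 l3 l4; rewrite M0 mulr0 subr0 => /le_lt_trans; apply; exact: lip.
Qed.

End TwoMeasures.

End Derivatives.

(** * Spectral classes, greatest indices and the final assembly *)

(** An eigenfunction of multiplication by [t] vanishes almost everywhere off [lam]; conversely the
    indicator of an atom is one. *)
Lemma sigma_pQ_mass (R : realType) (mu : {measure set R -> \bar R}) (lam : R[i]) :
  rint mu (fun t => (1 + t ^+ 2)^-1) -> sigma_pQ mu lam <-> mass mu lam != 0.
Proof.
move=> hmu; split=> [[f [_ [fn0 Ef]]]|m0].
  apply/eqP => m0; apply: fn0.
  apply: negligibleS (negligibleU Ef (level_negligible hmu m0)) => t /= ft.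
  apply: contrapT => /not_orP[/contrapT E tl]; apply: ft.
  move/eqP: E; rewrite -subr_eq0 -mulrBl mulf_eq0 subr_eq0 => /orP[/eqP //|/eqP //].
exists (at_pt lam); split; last split.
- split; first exact: inL2_at_pt.
  rewrite (_ : (fun t => _) = fun t => lam * at_pt lam t); first exact/inL2Z/inL2_at_pt.
  by apply/funext => t; apply/eqP; rewrite -subr_eq0 -mulrBl sub_at_pt.
- move=> E; have E1 : aeeq mu (fun t => 1 * at_pt lam t) (fun=> 0).
    by apply: aeeq_imp E => t; rewrite mul1r.
  by have /eqP := at_pt_ae0 hmu m0 E1; rewrite oner_eq0.
- by apply: aeeq_eq => t; apply/eqP; rewrite -subr_eq0 -mulrBl sub_at_pt.
Qed.

Lemma ole_le m n k : (m <= n)%N -> ole (Some n) k -> ole (Some m) k.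
Proof. by case: k => //= k; exact: leq_trans. Qed.

(** With [G n] meaning dimension at least [n], heredity identifies the exact dimension with the
    greatest admissible index; the lower bound [a] is consistent because [G a] holds. *)
Lemma greatestP (G : nat -> Prop) (a : nat) (P : option nat -> Prop) :
  (forall m n, (m <= n)%N -> G n -> G m) -> G a ->
  (forall k, P k <-> ole (Some a) k /\ forall j, ole (Some j) k -> G j) ->
  forall k, (match k with Some n => G n /\ ~ G n.+1 | None => forall n, G n end) <->
    is_greatest P k.
Proof.
move=> Gle Ga PE [n|].
  split=> [[Gn nG]|[/PE[an Pn] mx]].
    split.
      apply/PE; split=> [|j jn]; last exact: Gle Gn.
      by rewrite /ole leqNgt; apply/negP => na; apply: nG; exact: Gle Ga.
    move=> [m|] /PE[_ Pm]; last by case: nG; exact: Pm.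
    by rewrite /ole leqNgt; apply/negP => nm; apply: nG; exact: Pm.
  split; first by apply: Pn; rewrite /ole.
  move=> Gn1; have Pn1 : P (Some n.+1).
    by apply/PE; split=> [|j jn]; [exact: leqW|exact: Gle Gn1].
  by have := mx _ Pn1; rewrite /ole ltnn.
split=> [Gn|[/PE[_ Pn] _] n]; last exact: Pn.
by split; [apply/PE; split|case].
Qed.

Theorem theorem3p3 (R : realType)
  (mup mum : {measure set R -> \bar R}) (Cp Cm : R)
  (hp1 : (\int[mup]_t ((1 + t ^+ 2)^-1)%:E < +oo)%E)
  (hm1 : (\int[mum]_t ((1 + t ^+ 2)^-1)%:E < +oo)%E)
  (hp2 : mup setT = +oo%E) (hm2 : mum setT = +oo%E) :
  let Phi := fun z : R[i] => Mfun mup Cp z - Mfun mum Cm z in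
  (* 1) *)
  (forall lam : R[i], A0 mup lam \/ A0 mum lam -> ~ sigma_pA mup Cp mum Cm lam) /\
  (* 2) *)
  (forall lam : R[i], Ap mup lam -> Ap mum lam ->
     let c1 := atom mum lam = atom mup lam in
     let c2 := (\int[mup]_(t in [set t | (cR t) != lam]) (wpow lam 1 t)%:E < +oo)%E in
     let c3 := (\int[mum]_(t in [set t | (cR t) != lam]) (wpow lam 1 t)%:E < +oo)%E in
     [/\ sigma_pA mup Cp mum Cm lam /\ geom_mult mup Cp mum Cm lam (Some 1%N),
         alg_mult mup Cp mum Cm lam (Some 1%N) <-> ~ [/\ c1, c2 & c3] &
         ([/\ c1, c2 & c3] ->
          forall k : option nat,
            alg_mult mup Cp mum Cm lam k <->
            is_greatest (fun k' => ole (Some 2%N) k' /\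
               forall j : nat, (2 <= j)%N -> ole (Some j.+1) k' ->
                 [/\ (\int[mup]_(t in [set t | (cR t) != lam]) (wpow lam j t)%:E < +oo)%E,
                     (\int[mum]_(t in [set t | (cR t) != lam]) (wpow lam j t)%:E < +oo)%E &
                     lim0_vertical (cderivn (j - 2) Phi) lam]) k)]) /\
  (* 3) *)
  (forall lam : R[i], Ar mup lam -> Ar mum lam ->
     (sigma_pA mup Cp mum Cm lam <-> lim0_vertical Phi lam) /\
     (sigma_pA mup Cp mum Cm lam ->
        geom_mult mup Cp mum Cm lam (Some 1%N) /\
        forall k : option nat,
          alg_mult mup Cp mum Cm lam k <->
          is_greatest (fun k' => ole (Some 1%N) k' /\
             forall j : nat, (1 <= j)%N -> ole (Some j) k' ->
               [/\ (\int[mup]_t (wpow lam j t)%:E < +oo)%E,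
                   (\int[mum]_t (wpow lam j t)%:E < +oo)%E &
                   lim0_vertical (cderivn (j - 1) Phi) lam]) k)) /\
  (* 4) *)
  (forall lam : R[i], (Ap mup lam /\ Ar mum lam) \/ (Ap mum lam /\ Ar mup lam) ->
     ~ sigma_pA mup Cp mum Cm lam).
Proof.
move=> Phi.
have rintw (mu : {measure set R -> \bar R}) :
    (\int[mu]_t ((1 + t ^+ 2)^-1)%:E < +oo)%E -> rint mu (fun t => (1 + t ^+ 2)^-1).
  have w0 (t : R) : 0 <= (1 + t ^+ 2)^-1 by rewrite invr_ge0 ltW ?one_sqr_gt0.
  by move=> H; exact: (rintP mu (@measurable_wt R) w0).2.
have hp := rintw _ hp1; have hm := rintw _ hm1.
have notAp (mu : {measure set R -> \bar R}) lam : rint mu (fun t => (1 + t ^+ 2)^-1) ->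
    ~ sigma_pQ mu lam -> mass mu lam = 0.
  by move=> hmu nA; apply/eqP; apply: contraT => /(sigma_pQ_mass lam hmu).
have LP lam n : fins mup mum lam n.+1 -> mass mup lam = mass mum lam ->
    lim0_vertical (cderivn n Phi) lam <-> mdiff mup mum Cp Cm lam n = 0.
  by move=> fn Em; exact: lim0_vertical_Phi.
split; [|split; [|split]].
(* A nonzero [c] would make the squared resolvent integrable for both measures, against the
   divergence in [A0]. *)
- move=> lam [] [[np _ _] Winf]; (apply: no_eigenvalue => //; last by
    [left; exact: notAp|right; exact: notAp]).
  + move=> c bp bm _ fc _; apply: contrapT => /eqP c0; rewrite size_polyC c0 in fc.
    by have [/fin_powP + _] := fc 1%N isT; rewrite Winf.
  + move=> c bp bm _ fc _; apply: contrapT => /eqP c0; rewrite size_polyC c0 in fc.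
    by have [_ /fin_powP] := fc 1%N isT; rewrite Winf.
- move=> lam /(sigma_pQ_mass lam hp) mp0 /(sigma_pQ_mass lam hm) mm0 c1 c2 c3.
  have dimP n := dim_root_p Cp Cm hp hm hp2 mp0 mm0 n.
  have c1E : c1 <-> mass mup lam = mass mum lam.
    by rewrite /c1 /atom -!massE //; split=> [[]|->].
  have good1 : good_p mup mum Cp Cm lam 1 by split => //; exact: fins0.
  (* At index 2 the list of [mdiff] conditions is still empty, so dimension at least 2 amounts to
     the three conditions of (ii). *)
  have good2 : good_p mup mum Cp Cm lam 2 <-> [/\ c1, c2 & c3].
    split=> [[/(_ isT)/c1E ? f1 _]|[/c1E E /fin_pow_offP f1 /fin_pow_offP f2]].
      have [/fin_pow_offP ? /fin_pow_offP ?] := f1 1%N isT.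
      by split; auto.
    split=> //= j /andP[j0 j1]; have -> : j = 1%N by apply/eqP; rewrite eqn_leq j1.
    by split; auto.
  split.
  + split; [exact: sigma_pA_p|exact: geom_mult_p].
  + rewrite /alg_mult /dim_eq; split=> [[_ n2] c123|n123].
      by apply: n2; apply/dimP/good2.
    by split; [exact/dimP|move=> /dimP/good2].
  + move=> c123 k; have G2 := good2.2 c123.
    have [/(_ isT) Em f1 _] := G2.
    set P := (X in is_greatest X).
    apply: (iff_trans _ (greatestP (good_p_le (mup := mup) (mum := mum) (Cp := Cp) (Cm := Cm) (lam := lam)) G2 (P := P) _ k)).
      rewrite /alg_mult /dim_eq; case: k => [n|]; split.
      * by move=> [/dimP ? H]; split=> // ?; apply: H; apply/dimP.
      * by move=> [? H]; split=> [|/dimP//]; apply/dimP.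
      * by move=> H n; apply/dimP.
      * by move=> H n; apply/dimP.
    move=> k'; rewrite /P; split=> -[k2 H]; split=> //.
    * move=> j jk; have fj : fins mup mum lam j.-1.
        (* The conditions on [k'] start at exponent 2; exponent 1 comes from [c2] and [c3]. *)
        move=> i /andP[i0 ij]; have [i1|i1] := leqP i 1.
          by apply: f1; rewrite i0.
        have [|/fin_pow_offP ? /fin_pow_offP ? _] := H i i1.
          by apply: ole_le jk; rewrite -ltnS in ij *; case: (j) ij i0 => //; case: (i).
        by split; auto.
      split=> // i ij; apply/LP => //.
        exact: fins_le (leq_trans ij (leq_pred _)) fj.
      have [|_ _] := H i.+2 isT; last by rewrite -addn2 addnK.
      by apply: ole_le jk; move: ij; case: (j) => [|[|]].
    * move=> [|[|j]] // _ /H[_ fj Fj].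
      have [fj1 fj2] := fj j.+2 (leqnn _).
      split; [exact/fin_pow_offP|exact/fin_pow_offP|].
      rewrite -addn2 addnK; apply/LP => //; last exact: Fj.
      exact: fins_le fj.
- move=> lam [np fp] [nm fm]; have mp0 := notAp _ _ hp np; have mm0 := notAp _ _ hm nm.
  have f1 : fins mup mum lam 1.
    move=> j /andP[j0 j1]; have -> : j = 1%N by apply/eqP; rewrite eqn_leq j1.
    by split; exact/fin_powP.
  have Em : mass mup lam = mass mum lam by rewrite mp0.
  have sE := sigma_pA_r Cp Cm hp hm hp2 mp0 mm0 f1.
  have dimP n := dim_root_r Cp Cm hp hm hp2 mp0 mm0 n.
  split; first by rewrite sE -LP.
  move=> sA; split; first exact: geom_mult_r.
  have G1 : good_r mup mum Cp Cm lam 1 by split=> // -[] // _; exact/sE.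
  move=> k; set P := (X in is_greatest X).
  apply: (iff_trans _ (greatestP (good_r_le (mup := mup) (mum := mum) (Cp := Cp) (Cm := Cm) (lam := lam)) G1 (P := P) _ k)).
    rewrite /alg_mult /dim_eq; case: k => [n|]; split.
    + by move=> [/dimP ? H]; split=> // ?; apply: H; apply/dimP.
    + by move=> [? H]; split=> [|/dimP//]; apply/dimP.
    + by move=> H n; apply/dimP.
    + by move=> H n; apply/dimP.
  move=> k'; rewrite /P; split=> -[k1 H]; split=> //.
  + move=> j jk; have fj : fins mup mum lam j.
      move=> i /andP[i0 ij]; have [/fin_powP ? /fin_powP ? _] := H i i0 (ole_le ij jk).
      by split.
    split=> // i ij; apply/LP => //; first exact: fins_le fj.
    by have [_ _] := H i.+1 isT (ole_le ij jk); rewrite subn1.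
  + move=> [//|j] _ /H[fj Fj]; have [fj1 fj2] := fj j.+1 (leqnn _).
    by split; [exact/fin_powP|exact/fin_powP|rewrite subn1; apply/LP => //; exact: Fj].
(* With zero right-hand side the equation at the atom reads [0 = - c]; the other side has no atom,
   as [no_eigenvalue] requires. *)
- move=> lam [] [/(sigma_pQ_mass lam _) m0 [/notAp n0 _]];
    (apply: no_eigenvalue => //; last by [right; exact: n0|left; exact: n0]);
    move=> c bp bm [okp okm] _ _; apply/eqP; rewrite -oppr_eq0.
  + by rewrite -okp ?m0.
  + by rewrite -okm ?m0.
Qed.
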